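(* Let $s,r\ge4$. If the quotient algebra $\widetilde\Gamma(s,r)=k\widetilde Q(s,r)/I'$ is a Koszul AS-regular algebra of finite Gelfand–Kirillov dimension, then the relation set (generating $I'$) can be chosen as $$\widetilde\rho^\perp(s,r,C(a,b,c))=\{z(\alpha,\mathbf i,-a_{\mathbf i}^{-1}),\ z(\beta,\mathbf i,-b_{\mathbf i}^{-1}),\ z(\gamma,\mathbf i,-c_{\mathbf i}^{-1})\mid\mathbf i\in\mathbb Z/s\mathbb Z\times\mathbb Z/r\mathbb Z\}$$ for some family $C(a,b,c)=\{a_{\mathbf i},b_{\mathbf i},c_{\mathbf i}\mid \mathbf i\in\mathbb Z/s\mathbb Z\times\mathbb Z/r\mathbb Z\}\subset k^*$, where for $x\in k^*$ $$z(\gamma,\mathbf i,x)=x\beta_{\mathbf i+\mathbf e_1}\alpha_{\mathbf i}+\alpha_{\mathbf i+\mathbf e_2}\beta_{\mathbf i},\quad z(\beta,\mathbf i,x)=x\alpha_{\mathbf i-\mathbf e}\gamma_{\mathbf i}+\gamma_{\mathbf i+\mathbf e_1}\alpha_{\mathbf i},\quad z(\alpha,\mathbf i,x)=x\beta_{\mathbf i-\mathbf e}\gamma_{\mathbf i}+\gamma_{\mathbf i+\mathbf e_2}\beta_{\mathbf i}.$$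
   Context: $k$ is a field and $k^*$ its set of nonzero elements. Paths are composed from right to left. $\widetilde Q(s,r)$ is the McKay quiver of $\mathbb Z/s\mathbb Z\times\mathbb Z/r\mathbb Z$ embedded diagonally in $\mathrm{SL}(3,\mathbb C)$: its vertex set is $\mathbb Z/s\mathbb Z\times\mathbb Z/r\mathbb Z$, and for each vertex $\mathbf i$ there are arrows $\alpha_{\mathbf i}:\mathbf i\to\mathbf i+\mathbf e_1$, $\beta_{\mathbf i}:\mathbf i\to\mathbf i+\mathbf e_2$, $\gamma_{\mathbf i}:\mathbf i\to\mathbf i-\mathbf e$, where $\mathbf e_1=(1,0)$, $\mathbf e_2=(0,1)$, $\mathbf e=\mathbf e_1+\mathbf e_2$. Algebras are graded by path length. AS-regular is meant in the generalized sense for algebras with degree-zero part a product of copies of $k$: finite global dimension $d$, and for each graded simple $S$, $\operatorname{Ext}^i(S,\widetilde\Gamma)=0$ for $i\ne d$ while $\operatorname{Ext}^d(-,\widetilde\Gamma)$ permutes (up to shift, between left and right) the graded simples. In this section the AS-regular algebras considered are those of global dimension $3$ that are quadratic duals of stable $2$-translation algebras with trivial $2$-translation, i.e. of graded self-injective Koszul algebras of Loewy length $4$ with trivial Nakayama permutation. The quadratic dual of $kQ/(\rho)$, $\rho$ in the span $kQ_2$ of paths of length 2, is $kQ/(\rho^\perp)$, where $\rho^\perp$ spans the orthogonal complement of $\rho$ in each $e_jkQ_2e_i$ with the paths of length $2$ as a self-dual basis. The Gelfand–Kirillov dimension of a graded algebra $\Gamma$ generated in degrees $0,1$ is $\limsup_{N\to\infty}\log_N\sum_{t=1}^N\dim_k\Gamma_t$.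 *)

(* Defs.v *)
From HB Require Import structures.
From mathcomp Require Import all_boot all_order all_algebra.
From mathcomp Require Import all_classical all_reals all_analysis.
Set Implicit Arguments.
Unset Strict Implicit.
Unset Printing Implicit Defensive.
Import Order.TTheory GRing.Theory Num.Theory.
Local Open Scope classical_set_scope.
Local Open Scope ring_scope.

Record quiver := Quiver {
  vertex : finType;
  arrow : finType;
  source : arrow -> vertex;
  target : arrow -> vertex }.

(* A path of length n is a pair (v, [:: a1; ...; an]) with v the starting
   vertex and the arrows listed in the order in which they are traversed, so
   that it is the product a_n ... a_1 when paths are composed from right to
   left.  The pair (v, [::]) is the trivial path e_v. *)
Section Paths.
Variable Q : quiver.

Fixpoint composable (v : vertex Q) (s : seq (arrow Q)) : bool :=
  if s is a :: s' then (source a == v) && composable (target a) s' else true.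

Fixpoint walk_end (v : vertex Q) (s : seq (arrow Q)) : vertex Q :=
  if s is a :: s' then walk_end (target a) s' else v.

Lemma composable_cat v s1 s2 :
  composable v (s1 ++ s2) = composable v s1 && composable (walk_end v s1) s2.
Proof. by elim: s1 v => //= a s IH v; rewrite IH andbA. Qed.

Lemma walk_end_cat v s1 s2 :
  walk_end v (s1 ++ s2) = walk_end (walk_end v s1) s2.
Proof. by elim: s1 v => /=. Qed.

End Paths.

(* An element of kQ is given by its coefficients; as Q is finite, having
   finite support means vanishing on all sufficiently long paths.  For
   convenience coefficients are indexed by all pairs (v, s) and vanish on
   those which are not paths. *)
Record path_alg (k : fieldType) (Q : quiver) := PathAlg {
  pcoef :> vertex Q -> seq (arrow Q) -> k;
  pcoef_fin : exists N, forall v s, (N <= size s)%N -> pcoef v s = 0;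
  pcoef_path : forall v s, ~~ composable v s -> pcoef v s = 0 }.

HB.instance Definition _ k Q := gen_eqMixin (path_alg k Q).
HB.instance Definition _ k Q := gen_choiceMixin (path_alg k Q).

Section PathAlgebra.
Variables (k : fieldType) (Q : quiver).
Local Notation kQ := (path_alg k Q).
Implicit Types f g h : kQ.

Lemma path_algP f g : (forall v s, f v s = g v s) -> f = g.
Proof.
case: f g => [f f1 f2] [g g1 g2] /= fg.
have e : f = g by apply/funext => v; apply/funext => s; exact: fg.
subst g; congr PathAlg; exact: Prop_irrelevance.
Qed.

Program Definition pzero : kQ := @PathAlg k Q (fun _ _ => 0) _ _.
Next Obligation. by exists 0%N. Qed.
Next Obligation. by []. Qed.

Program Definition popp f : kQ := @PathAlg k Q (fun v s => - f v s) _ _.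
Next Obligation.
by move=> f; have [N hN] := pcoef_fin f; exists N => v s /hN ->; rewrite oppr0.
Qed.
Next Obligation. by move=> f v s hs /=; rewrite (pcoef_path f hs) oppr0. Qed.

Program Definition padd f g : kQ := @PathAlg k Q (fun v s => f v s + g v s) _ _.
Next Obligation.
move=> f g; have [N hN] := pcoef_fin f; have [M hM] := pcoef_fin g.
by exists (maxn N M) => v s; rewrite geq_max => /andP[/hN -> /hM ->]; rewrite addr0.
Qed.
Next Obligation.
by move=> f g v s hs /=; rewrite (pcoef_path f hs) (pcoef_path g hs) addr0.
Qed.

Program Definition pscale (c : k) f : kQ := @PathAlg k Q (fun v s => c * f v s) _ _.
Next Obligation.
by move=> c f; have [N hN] := pcoef_fin f; exists N => v s /hN ->; rewrite mulr0.
Qed.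
Next Obligation. by move=> c f v s hs /=; rewrite (pcoef_path f hs) mulr0. Qed.

Program Definition pone : kQ := @PathAlg k Q (fun _ s => (s == [::])%:R) _ _.
Next Obligation. by exists 1%N => v [|]. Qed.
Next Obligation. by move=> v [|]. Qed.

(* Bilinear extension of right-to-left concatenation of paths: the coefficient
   of a path in f g is summed over the ways to cut it into an initial part,
   coming from g, and a final part, coming from f. *)
Program Definition pmul f g : kQ := @PathAlg k Q
  (fun v s => \sum_(m < (size s).+1)
     f (walk_end v (take m s)) (drop m s) * g v (take m s)) _ _.
Next Obligation.
move=> f g; have [N hN] := pcoef_fin f; have [M hM] := pcoef_fin g.
exists (N + M)%N => v s hs; apply: big1 => m _.
have [hm|hm] := leqP M m.
  by rewrite (hM v) ?mulr0 // size_take_min leq_min hm /=; apply: leq_trans hs; rewrite leq_addl.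
rewrite hN ?mul0r // size_drop leq_subRL ?(leq_trans _ (ltn_ord m)) //; last first.
  by rewrite -ltnS.
by apply: leq_trans hs; rewrite addnC leq_add2l ltnW.
Qed.
Next Obligation.
move=> f g v s hs; apply: big1 => m _.
move: hs; rewrite -{1}(cat_take_drop m s) composable_cat negb_and.
by case/orP => hs; rewrite ?(pcoef_path g hs) ?(pcoef_path f hs) ?mulr0 ?mul0r.
Qed.

Lemma paddA : associative padd.
Proof. by move=> f g h; apply: path_algP => v s /=; rewrite addrA. Qed.
Lemma paddC : commutative padd.
Proof. by move=> f g; apply: path_algP => v s /=; rewrite addrC. Qed.
Lemma padd0 : left_id pzero padd.
Proof. by move=> f; apply: path_algP => v s /=; rewrite add0r. Qed.
Lemma paddN : left_inverse pzero popp padd.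
Proof. by move=> f; apply: path_algP => v s /=; rewrite addNr. Qed.

HB.instance Definition _ := GRing.isZmodule.Build kQ paddA paddC padd0 paddN.

Lemma pmul1 : left_id pone pmul.
Proof.
move=> f; apply: path_algP => v s /=.
rewrite big_ord_recr /= drop_size take_size eqxx mul1r big1 ?add0r // => m _.
by rewrite -size_eq0 size_drop subn_eq0 leqNgt ltn_ord mul0r.
Qed.

Lemma pmulr1 : right_id pone pmul.
Proof.
move=> f; apply: path_algP => v s /=.
rewrite big_ord_recl /= take0 drop0 eqxx mulr1 big1 ?addr0 // => m _ /=.
case: s m => [[]|a s m] //=.
by rewrite /bump /= mulr0.
Qed.

Lemma pmulDl : left_distributive pmul padd.
Proof.
move=> f g h; apply: path_algP => v s /=; rewrite -big_split /=.
by apply: eq_bigr => m _; rewrite mulrDl.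
Qed.

Lemma pmulDr : right_distributive pmul padd.
Proof.
move=> f g h; apply: path_algP => v s /=; rewrite -big_split /=.
by apply: eq_bigr => m _; rewrite mulrDr.
Qed.

Lemma pmulA : associative pmul.
Proof.
move=> f g h; apply: path_algP => v s /=.
pose F (m l : nat) := f (walk_end v (take m s)) (drop m s) *
  g (walk_end v (take l s)) (drop l (take m s)) * h v (take l s).
transitivity (\sum_(0 <= m < (size s).+1) \sum_(0 <= l < (size s).+1 | (l <= m)%N) F m l).
  rewrite big_mkord; apply: eq_bigr => m _.
  have ms : (m <= size s)%N by rewrite -ltnS.
  rewrite size_takel // mulr_sumr big_mkord.
  rewrite (big_ord_widen_cond (size s).+1 predT (fun l =>
    f (walk_end v (take m s)) (drop m s) * (g (walk_end v (take l (take m s)))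
     (drop l (take m s)) * h v (take l (take m s))))) //=.
  apply: eq_big => [l|l]; first by rewrite ltnS.
  by rewrite ltnS => lm; rewrite take_takel // mulrA.
rewrite (exchange_big_dep_nat predT) //= big_mkord; apply: eq_bigr => l _.
have ls : (l <= size s)%N by rewrite -ltnS.
rewrite size_drop mulr_suml.
transitivity (\sum_(l <= m < (size s).+1) F m l).
  by rewrite (@big_nat_widenl _ _ _ l 0).
rewrite -{1}(add0n (l : nat)) big_addn subSn // big_mkord.
apply: eq_bigr => j _.
by rewrite /F drop_drop -walk_end_cat -takeD take_drop (addnC l j).
Qed.

HB.instance Definition _ := GRing.Zmodule_isPzRing.Build kQ
  pmulA pmul1 pmulr1 pmulDl pmulDr.

Lemma pscaleA (a b : k) f : pscale a (pscale b f) = pscale (a * b) f.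
Proof. by apply: path_algP => v s /=; rewrite mulrA. Qed.
Lemma pscale1 : left_id 1 pscale.
Proof. by move=> f; apply: path_algP => v s /=; rewrite mul1r. Qed.
Lemma pscaleDr : right_distributive pscale +%R.
Proof. by move=> c f g; apply: path_algP => v s /=; rewrite mulrDr. Qed.
Lemma pscaleDl f : {morph pscale^~ f : a b / a + b}.
Proof. by move=> a b; apply: path_algP => v s /=; rewrite mulrDl. Qed.

HB.instance Definition _ := GRing.Zmodule_isLmodule.Build k kQ
  pscaleA pscale1 pscaleDr pscaleDl.

Program Definition pvertex (i : vertex Q) : kQ :=
  @PathAlg k Q (fun v s => ((v == i) && (s == [::]))%:R) _ _.
Next Obligation. by move=> i; exists 1%N => v [|a s] //; rewrite andbF. Qed.
Next Obligation. by move=> i v [|a s] //; rewrite andbF. Qed.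

Program Definition parrow (a : arrow Q) : kQ :=
  @PathAlg k Q (fun v s => ((v == source a) && (s == [:: a]))%:R) _ _.
Next Obligation.
by move=> a; exists 2%N => v [|b [|c s]] // _; rewrite ?andbF // eqseq_cons /= !andbF.
Qed.
Next Obligation.
move=> a v s; apply: contraNeq => /=.
by case: andP => [[/eqP-> /eqP->] _|_]; rewrite /= eqxx.
Qed.

Definition path_deg (t : nat) : set kQ :=
  [set f | forall v s, f v s != 0 -> size s = t].

Definition path_deg_ge (t : nat) : set kQ :=
  [set f | forall v s, f v s != 0 -> (t <= size s)%N].

(* The bilinear form on kQ_2 for which the paths of length 2 are orthonormal. *)
Definition pair2 f g : k :=
  \sum_(v : vertex Q) \sum_(s : 2.-tuple (arrow Q)) f v s * g v s.

Definition quad_perp (rho : set kQ) : set kQ :=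
  [set f | (exists i j, path_deg 2 f /\ f = pvertex j * f * pvertex i) /\
           (forall g, rho g -> pair2 f g = 0)].

Record ideal := Ideal {
  ideal_set :> set kQ;
  ideal0 : ideal_set 0;
  idealD : forall x y, ideal_set x -> ideal_set y -> ideal_set (x + y);
  idealM : forall a x b, ideal_set x -> ideal_set (a * x * b) }.

Program Definition ideal_gen (rho : set kQ) : ideal :=
  @Ideal [set x | forall J : ideal, rho `<=` J -> ideal_set J x] _ _ _.
Next Obligation. by move=> rho J _; apply: ideal0. Qed.
Next Obligation. by move=> rho x y hx hy J hJ; apply: idealD; [apply: hx|apply: hy]. Qed.
Next Obligation. by move=> rho a x b hx J hJ; apply: idealM; apply: hx. Qed.

Section BoundAlgebra.
Variable I : ideal.

Lemma idealN x : ideal_set I x -> ideal_set I (- x).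
Proof. by move=> /(idealM (-1) 1); rewrite mulr1 mulN1r. Qed.

Definition ideal_eqv : rel kQ := fun x y => `[< ideal_set I (x - y) >].

Lemma ideal_eqv_refl : reflexive ideal_eqv.
Proof. by move=> x; apply/asboolP; rewrite subrr; apply: ideal0. Qed.
Lemma ideal_eqv_sym : symmetric ideal_eqv.
Proof.
move=> x y; apply/asboolP/asboolP => /idealN; by rewrite opprB.
Qed.
Lemma ideal_eqv_trans : transitive ideal_eqv.
Proof.
move=> y x z /asboolP xy /asboolP yz; apply/asboolP.
by have := idealD xy yz; rewrite addrA subrK.
Qed.

Canonical ideal_equiv :=
  EquivRel ideal_eqv ideal_eqv_refl ideal_eqv_sym ideal_eqv_trans.

Definition bound_alg := {eq_quot ideal_equiv}%qT.
HB.instance Definition _ := Choice.on bound_alg.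
HB.instance Definition _ := EqQuotient.on bound_alg.

Definition quo (x : kQ) : bound_alg := \pi_bound_alg%qT x.

Lemma quoP x y : quo x = quo y <-> ideal_set I (x - y).
Proof. by split => [/eqmodP/asboolP|h]; last apply/eqmodP/asboolP. Qed.

Lemma quo_repr (x : bound_alg) : quo (repr x)%qT = x.
Proof. exact: reprK. Qed.

Definition qzero : bound_alg := quo 0.
Definition qone : bound_alg := quo 1.
Definition qopp (x : bound_alg) : bound_alg := quo (- repr x)%qT.
Definition qadd (x y : bound_alg) : bound_alg := quo (repr x + repr y)%qT.
Definition qmul (x y : bound_alg) : bound_alg := quo (repr x * repr y)%qT.
Definition qscale (c : k) (x : bound_alg) : bound_alg := quo (c *: repr x)%qT.

Lemma quo_reprB x : ideal_set I ((repr (quo x))%qT - x).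
Proof. by apply/quoP; rewrite quo_repr. Qed.

Lemma quoN x : qopp (quo x) = quo (- x).
Proof. by apply/quoP; rewrite -opprD; apply/idealN/quo_reprB. Qed.

Lemma quoD x y : qadd (quo x) (quo y) = quo (x + y).
Proof.
by apply/quoP; rewrite opprD addrACA; apply: idealD; apply: quo_reprB.
Qed.

Lemma quoM x y : qmul (quo x) (quo y) = quo (x * y).
Proof.
apply/quoP; set x' := repr _; set y' := repr _.
have -> : x' * y' - x * y = 1 * (x' - x) * y' + x * (y' - y) * 1.
  by rewrite mul1r mulr1 mulrBl mulrBr addrA subrK.
by apply: idealD; apply: idealM; apply: quo_reprB.
Qed.

Lemma scale_path_alg (c : k) (x : kQ) : c *: x = (c *: (1 : kQ) : kQ) * x.
Proof.
apply: path_algP => v s /=.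
rewrite big_ord_recr /= drop_size take_size eqxx mulr1 big1 ?add0r // => m _.
by rewrite -size_eq0 size_drop subn_eq0 leqNgt ltn_ord mulr0 mul0r.
Qed.

Lemma quoZ c x : qscale c (quo x) = quo (c *: x).
Proof.
apply/quoP; rewrite -scalerBr scale_path_alg -[X in ideal_set _ X]mulr1.
by apply: idealM; apply: quo_reprB.
Qed.

Lemma quoW (P : bound_alg -> Prop) : (forall x, P (quo x)) -> forall x, P x.
Proof. by move=> h x; rewrite -[x]quo_repr. Qed.

Lemma qaddA : associative qadd.
Proof. by do 3![elim/quoW => ?]; rewrite !quoD addrA. Qed.
Lemma qaddC : commutative qadd.
Proof. by do 2![elim/quoW => ?]; rewrite !quoD addrC. Qed.
Lemma qadd0 : left_id qzero qadd.
Proof. by elim/quoW => ?; rewrite quoD add0r. Qed.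
Lemma qaddN : left_inverse qzero qopp qadd.
Proof. by elim/quoW => ?; rewrite quoN quoD addNr. Qed.

HB.instance Definition _ := GRing.isZmodule.Build bound_alg qaddA qaddC qadd0 qaddN.

Lemma qmulA : associative qmul.
Proof. by do 3![elim/quoW => ?]; rewrite !quoM mulrA. Qed.
Lemma qmul1 : left_id qone qmul.
Proof. by elim/quoW => ?; rewrite quoM mul1r. Qed.
Lemma qmulr1 : right_id qone qmul.
Proof. by elim/quoW => ?; rewrite quoM mulr1. Qed.
Lemma qmulDl : left_distributive qmul qadd.
Proof. by do 3![elim/quoW => ?]; rewrite !(quoD, quoM) mulrDl. Qed.
Lemma qmulDr : right_distributive qmul qadd.
Proof. by do 3![elim/quoW => ?]; rewrite !(quoD, quoM) mulrDr. Qed.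

HB.instance Definition _ := GRing.Zmodule_isPzRing.Build bound_alg
  qmulA qmul1 qmulr1 qmulDl qmulDr.

Lemma qscaleA (a b : k) x : qscale a (qscale b x) = qscale (a * b) x.
Proof. by elim/quoW: x => x; rewrite !quoZ scalerA. Qed.
Lemma qscale1 : left_id 1 qscale.
Proof. by elim/quoW => x; rewrite quoZ scale1r. Qed.
Lemma qscaleDr : right_distributive qscale qadd.
Proof.
by move=> c; do 2![elim/quoW => ?]; rewrite !(quoD, quoZ) scalerDr.
Qed.
Lemma qscaleDl x : {morph qscale^~ x : a b / a + b >-> qadd a b}.
Proof.
by move=> a b /=; elim/quoW: x => x; rewrite !(quoZ, quoD) scalerDl.
Qed.

HB.instance Definition _ := GRing.Zmodule_isLmodule.Build k bound_alg
  qscaleA qscale1 qscaleDr qscaleDl.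

End BoundAlgebra.
End PathAlgebra.

(* Right A-modules are modules over the converse ring A^c. *)

Section Homological.
Variable A : pzRingType.

Definition projective (P : lmodType A) : Prop :=
  forall (M N : lmodType A) (g : {linear M -> N}) (f : {linear P -> N}),
    (forall y, exists x, g x = y) ->
    exists h : {linear P -> M}, forall x, g (h x) = f x.

Definition injective_module (E : lmodType A) : Prop :=
  forall (M N : lmodType A) (i : {linear M -> N}) (f : {linear M -> E}),
    injective i ->
    exists h : {linear N -> E}, forall x, h (i x) = f x.

Record proj_res (M : lmodType A) := ProjRes {
  pr_mod :> nat -> lmodType A;
  pr_diff : forall n, {linear pr_mod n.+1 -> pr_mod n};
  pr_aug : {linear pr_mod 0 -> M};
  pr_proj : forall n, projective (pr_mod n);
  pr_aug_surj : forall y, exists x, pr_aug x = y;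
  pr_exact0 : forall x, pr_aug x = 0 <-> exists y, pr_diff 0 y = x;
  pr_exact : forall n x, pr_diff n x = 0 <-> exists y, pr_diff n.+1 y = x }.

Definition pd_le (M : lmodType A) (n : nat) : Prop :=
  exists P : proj_res M, forall m, (n < m)%N -> forall x : P m, x = 0.

Definition gldim_eq (d : nat) : Prop :=
  forall n, (forall M : lmodType A, pd_le M n) <-> (d <= n)%N.

Section Ext.
Variables (M : lmodType A) (P : proj_res M).

Definition cocycle (N : lmodType A) (n : nat) (f : {linear P n -> N}) : Prop :=
  forall x, f (pr_diff P n x) = 0.

Definition coboundary (N : lmodType A) (n : nat) :
    {linear P n -> N} -> Prop :=
  match n return {linear P n -> N} -> Prop with
  | 0 => fun f => forall x, f x = 0
  | m.+1 => fun f => exists g : {linear P m -> N},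
              forall x, f x = g (pr_diff P m x)
  end.

Definition ext_zero (N : lmodType A) (n : nat) : Prop :=
  forall f : {linear P n -> N}, cocycle f -> coboundary f.

(* Ext^n(M, A), computed with P, is isomorphic to E as a right A-module; A acts
   on homomorphisms to A by (f a)(x) = f(x) a. *)
Definition ext_ring_iso (n : nat) (E : lmodType A^c) : Prop :=
  exists phi : {linear P n -> A^o} -> E,
    [/\ forall f g h : {linear P n -> A^o}, cocycle f -> cocycle g ->
          (forall x, h x = f x + g x) -> phi h = phi f + phi g,
        forall (f h : {linear P n -> A^o}) (a : A), cocycle f ->
          (forall x, h x = (f x : A) * a) -> phi h = (a : A^c) *: phi f,
        forall f : {linear P n -> A^o}, cocycle f -> (phi f = 0 <-> coboundary f)
      & forall e, exists f, cocycle f /\ phi f = e].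

End Ext.

(* A grading of M = \bigoplus_n M_n, with respect to a grading G of A. *)
Definition is_graded_module (G : nat -> set A) (M : lmodType A)
    (Mg : nat -> set M) : Prop :=
  [/\ forall n, Mg n 0 /\ (forall x y, Mg n x -> Mg n y -> Mg n (x - y)),
      forall t n a x, G t a -> Mg n x -> Mg (t + n)%N (a *: x),
      forall x, exists N (y : nat -> M),
        (forall n, Mg n (y n)) /\ x = \sum_(n < N) y n
    & forall N (y : nat -> M), (forall n, Mg n (y n)) ->
        \sum_(n < N) y n = 0 -> forall n, (n < N)%N -> y n = 0].

Definition generated_by (M : lmodType A) (S : set M) : Prop :=
  forall x, exists N (a : nat -> A) (y : nat -> M),
    (forall n, S (y n)) /\ x = \sum_(n < N) a n *: y n.

End Homological.

(* kQ/I is graded by path length when I is homogeneous, and the modules of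
   [vertex_simple] are its graded simple modules when moreover I contains no
   combination of paths of length 0. *)

Section GradedAlgebras.
Variables (k : fieldType) (Q : quiver).
Local Notation kQ := (path_alg k Q).
Implicit Types I : ideal k Q.

Definition alg_deg I (t : nat) : set (bound_alg I) :=
  @quo k Q I @` @path_deg k Q t.
Arguments alg_deg : clear implicits.

(* J^t, with J the ideal of kQ/I generated by the arrows.  When kQ/I is finite
   dimensional and I is generated in degrees >= 2, J is the Jacobson radical. *)
Definition rad_pow I (t : nat) : set (bound_alg I) :=
  @quo k Q I @` @path_deg_ge k Q t.
Arguments rad_pow : clear implicits.

(* S is the simple module at the vertex i: it is k as a vector space, e_i acts
   as the identity and the arrows act as 0.  The ring B is kQ/I or its
   converse, and u : kQ -> B is the projection. *)
Definition vertex_simple (B : pzRingType) (u : kQ -> B) (i : vertex Q)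
    (S : lmodType B) : Prop :=
  exists x : S,
    [/\ x != 0, forall y, exists c : k, y = u (c *: (1 : kQ)) *: x,
        u (pvertex k i) *: x = x
      & forall a, u (parrow k a) *: x = 0].

Definition left_simple I (i : vertex Q) (S : lmodType (bound_alg I)) : Prop :=
  vertex_simple (@quo k Q I) i S.

Definition right_simple I (i : vertex Q) (S : lmodType (bound_alg I)^c) : Prop :=
  vertex_simple (fun x => quo I x : (bound_alg I)^c) i S.

(* Each graded simple module, put in degree 0, has a graded projective
   resolution whose n-th term is generated in degree n. *)
Definition koszul I : Prop :=
  forall i (S : lmodType (bound_alg I)), left_simple i S ->
  exists (P : proj_res S) (G : forall n, nat -> set (P n)),
    [/\ forall n, is_graded_module (alg_deg I) (G n),
        forall m x, (0 < m)%N -> G 0%N m x -> pr_aug P x = 0,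
        forall n m x, G n.+1 m x -> G n m (pr_diff P n x)
      & forall n, generated_by (G n n)].

(* Since the terms of a minimal resolution of a graded simple module over a
   Koszul algebra are finitely generated, the ungraded Ext used here is the
   underlying module of the graded one; "up to shift" is then automatic. *)
Definition AS_regular (d : nat) I : Prop :=
  gldim_eq (bound_alg I) d /\
  exists sigma : vertex Q -> vertex Q, bijective sigma /\
    forall i (S : lmodType (bound_alg I)), left_simple i S ->
    exists P : proj_res S,
      (forall n, n <> d -> ext_zero P (bound_alg I)^o n) /\
      exists E : lmodType (bound_alg I)^c,
        right_simple (sigma i) E /\ ext_ring_iso P d E.

Definition self_injective I : Prop := injective_module (bound_alg I)^o.

Definition loewy_length I (l : nat) : Prop :=
  forall t, (forall x, rad_pow I t x -> x = 0) <-> (l <= t)%N.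

(* The socle of the indecomposable projective module (kQ/I) e_i. *)
Definition socle I (i : vertex Q) : set (bound_alg I) :=
  [set x | x = x * quo I (pvertex k i) /\ forall y, rad_pow I 1 y -> y * x = 0].
Arguments socle : clear implicits.

(* The socle of (kQ/I) e_i is the simple module at the vertex nu i. *)
Definition nakayama_perm I (nu : vertex Q -> vertex Q) : Prop :=
  bijective nu /\
  forall i, exists x : bound_alg I,
    [/\ x != 0, quo I (pvertex k (nu i)) * x = x
      & socle I i = [set c *: x | c in [set: k]]].

(* Stable n-translation algebras have Loewy length n + 2, and the Nakayama
   permutation is the n-translation on vertices. *)
Definition trivial_stable_translation (n : nat) I : Prop :=
  [/\ koszul I, self_injective I, loewy_length I n.+2 & nakayama_perm I id].

Definition has_dim (M : lmodType k) (S : set M) (n : nat) : Prop :=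
  exists b : 'I_n -> M,
    (forall c : 'I_n -> k, \sum_i c i *: b i = 0 -> forall i, c i = 0) /\
    S = [set x | exists c : 'I_n -> k, x = \sum_i c i *: b i].

Definition dimk (M : lmodType k) (S : set M) : nat := xget 0%N (has_dim S).

(* ln 0 = 0, so that the value is 0 instead of -oo when kQ/I is concentrated in
   degree 0. *)
Definition GKdim (R : realType) I : \bar R :=
  limn_esup (fun N : nat =>
    (ln (\sum_(1 <= t < N.+1) dimk (alg_deg I t))%:R / ln N%:R)%:E).

End GradedAlgebras.

Section McKay.
Variables (k : fieldType) (s r : nat).

Definition mvertex := ('Z_s * 'Z_r)%type.
Definition e1 : mvertex := (1, 0).
Definition e2 : mvertex := (0, 1).

(* The arrows alpha_i, beta_i, gamma_i are inl (inl i), inl (inr i), inr i. *)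
Definition marrow := (mvertex + mvertex + mvertex)%type.

Definition msource (x : marrow) : mvertex :=
  match x with inl (inl i) | inl (inr i) | inr i => i end.

Definition mtarget (x : marrow) : mvertex :=
  match x with
  | inl (inl i) => i + e1
  | inl (inr i) => i + e2
  | inr i => i - (e1 + e2)
  end.

Definition mckay : quiver := Quiver msource mtarget.

Local Notation kQ := (path_alg k mckay).

Definition alpha (i : mvertex) : kQ := @parrow k mckay (inl (inl i)).
Definition beta (i : mvertex) : kQ := @parrow k mckay (inl (inr i)).
Definition gamma (i : mvertex) : kQ := @parrow k mckay (inr i).

Definition z_gamma (i : mvertex) (x : k) : kQ :=
  x *: (beta (i + e1) * alpha i : kQ) + alpha (i + e2) * beta i.
Definition z_beta (i : mvertex) (x : k) : kQ :=
  x *: (alpha (i - (e1 + e2)) * gamma i : kQ) + gamma (i + e1) * alpha i.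
Definition z_alpha (i : mvertex) (x : k) : kQ :=
  x *: (beta (i - (e1 + e2)) * gamma i : kQ) + gamma (i + e2) * beta i.

Definition rho_perp (a b c : mvertex -> k) : set kQ :=
  [set z | exists i, [\/ z = z_alpha i (- (a i)^-1),
                         z = z_beta i (- (b i)^-1)
                       | z = z_gamma i (- (c i)^-1)]].

End McKay.

(* Main.v *)
Require Import Defs.
From mathcomp Require Import all_boot all_order all_algebra.
From mathcomp Require Import all_classical all_reals all_analysis.
Set Implicit Arguments.
Unset Strict Implicit.
Unset Printing Implicit Defensive.
Import Order.TTheory GRing.Theory Num.Theory.
Local Open Scope classical_set_scope.
Local Open Scope ring_scope.

(** Write L = kQ/(rho) and let G be its quadratic dual.

    Structure of L in degree 2.  As s, r >= 4, the closed paths of length at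
    most 3 of the quiver are the trivial paths and the triangles made of one
    alpha, one beta and one gamma.  The socle of L e_i is a line of closed
    paths at i, so it lies in degree 3.  Since L vanishes in degree 4, an
    element of e_j L_2 e_i that every arrow kills lies in the socle, hence is
    zero: a nonzero element is detected by an arrow from j to i.  There is at
    most one such arrow.  Consequently the paths alpha alpha, beta beta and
    gamma gamma vanish in L ([relation_no_arrow]), and the two paths around a
    commutativity square span at most a line ([deg2_le1]).  Moreover every arrow
    is part of a nonzero cycle of length 3 ([arrow_completes]), which makes the
    vanishing of a product of two sides of a triangle invariant under rotation
    of the triangle ([relation_rotate]).

    If no product of two arrows of different types vanishes in L, each square
    carries one relation in L with both coefficients nonzero, and its orthogonal
    complement is the line of a relation z(-, i, x) with x nonzero ([quad_perp_zrel]).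

    So assume that q p = 0 in L for two sides of a triangle p, q, t.  By rotation
    t q = p t = 0 as well.  A path of length 2 that vanishes in L has
    coefficient zero in all relations of G ([quad_perp_coef0]).  Hence a path all
    of whose consecutive pairs of arrows vanish in L has coefficient zero in the
    whole ideal of G: such rigid paths are linearly independent in G.  The
    triangle t q p is a rigid cycle.  Another one goes through p, follows the
    straight line of arrows of the type of q around the torus until it has
    gone through q a second time, and closes up with t.  These two cycles generate
    freely a monoid of rigid cycles, so G grows exponentially, which contradicts
    finite Gelfand-Kirillov dimension ([path2_nonzero]). *)

(** * Coefficients and ideals in path algebras *)

Section PathCalculus.
Variables (k : fieldType) (Q : quiver).
Local Notation kQ := (path_alg k Q).
Implicit Types (f g h : kQ) (I : ideal k Q).

Lemma path_alg_scalerAl (c : k) f g : c *: (f * g) = (c *: f) * g.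
Proof. by rewrite scale_path_alg mulrA -scale_path_alg. Qed.

Lemma path_alg_scalerAr (c : k) f g : c *: (f * g) = f * (c *: g).
Proof.
apply: path_algP => v s /=; rewrite mulr_sumr; apply: eq_bigr => m _.
by rewrite mulrCA.
Qed.

Lemma pcoef_sum (J : Type) (e : seq J) (P : pred J) (F : J -> kQ) v s :
  (\sum_(i <- e | P i) F i : kQ) v s = \sum_(i <- e | P i) F i v s.
Proof. by apply: (big_morph (fun f : kQ => f v s)). Qed.

Lemma pcoef_mul f g v s : (f * g) v s =
  \sum_(m < (size s).+1) f (walk_end v (take m s)) (drop m s) * g v (take m s).
Proof. by []. Qed.

Lemma ideal_mull I f g : ideal_set I g -> ideal_set I (f * g).
Proof. by move=> /(idealM f 1); rewrite mulr1. Qed.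

Lemma ideal_mulr I f g : ideal_set I f -> ideal_set I (f * g).
Proof. by move=> /(idealM 1 g); rewrite mul1r. Qed.

Lemma ideal_scale I (c : k) f : ideal_set I f -> ideal_set I (c *: f).
Proof. by rewrite scale_path_alg; apply: ideal_mull. Qed.

Lemma idealB I f g : ideal_set I f -> ideal_set I g -> ideal_set I (f - g).
Proof. by move=> hf hg; apply: idealD => //; apply: idealN. Qed.

Lemma ideal_sum I (J : Type) (e : seq J) (P : pred J) (F : J -> kQ) :
  (forall i, P i -> ideal_set I (F i)) -> ideal_set I (\sum_(i <- e | P i) F i).
Proof. by move=> h; elim/big_ind: _ => //; [apply: ideal0 | apply: idealD]. Qed.

Lemma sub_ideal_gen (rho : set kQ) : rho `<=` ideal_set (ideal_gen rho).
Proof. by move=> f hf J; apply. Qed.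

Lemma ideal_gen_min (rho : set kQ) I :
  rho `<=` ideal_set I -> ideal_set (ideal_gen rho) `<=` ideal_set I.
Proof. by move=> h f; apply. Qed.

Lemma path_deg0 t f v s : path_deg t f -> size s != t -> f v s = 0.
Proof. by move=> h; apply: contraNeq => /h ->. Qed.

Lemma path_deg_ge0 t f v s : path_deg_ge t f -> (size s < t)%N -> f v s = 0.
Proof. by move=> h; rewrite ltnNge; apply: contraNeq => /h. Qed.

Lemma path_degW t f : path_deg t f -> path_deg_ge t f.
Proof. by move=> h v s /h ->. Qed.

Lemma path_deg_mul m n f g :
  path_deg m f -> path_deg n g -> path_deg (m + n)%N (f * g).
Proof.
move=> hf hg v s; apply: contraNeq => st; rewrite pcoef_mul big1 // => l _.
have [e|/(path_deg0 _ hg)->] := eqVneq (size (take l s)) n; last by rewrite mulr0.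
rewrite (path_deg0 _ hf) ?mul0r //; apply: contraNneq st => <-.
by rewrite -e addnC -size_cat cat_take_drop.
Qed.

Lemma path_deg_ge_mul m n f g :
  path_deg_ge m f -> path_deg_ge n g -> path_deg_ge (m + n)%N (f * g).
Proof.
move=> hf hg v s; apply: contraNleq => st; rewrite pcoef_mul big1 // => l _.
have [/(path_deg_ge0 _ hg)->|e] := ltnP (size (take l s)) n; first by rewrite mulr0.
rewrite (path_deg_ge0 _ hf) ?mul0r // -(ltn_add2r n) (leq_ltn_trans _ st) //.
apply: (@leq_trans (size (take l s ++ drop l s))); last by rewrite cat_take_drop.
by rewrite size_cat addnC leq_add2r.
Qed.

Lemma parrow_deg a : path_deg 1 (parrow k a : kQ).
Proof.
move=> v s /=; case: (altP (s =P [:: a])) => [->//|_].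
by rewrite andbF eqxx.
Qed.

Lemma pcoef_vertex_mul j f v s :
  (pvertex k j * f) v s = if walk_end v s == j then f v s else 0.
Proof.
rewrite pcoef_mul big_ord_recr drop_size take_size big1 => [|m _] /=.
  by rewrite andbT add0r; case: eqP => _; rewrite ?mul1r ?mul0r.
by rewrite -[_ == [::]]size_eq0 size_drop subn_eq0 leqNgt ltn_ord andbF mul0r.
Qed.

Lemma pcoef_mul_vertex i f v s :
  (f * pvertex k i) v s = if v == i then f v s else 0.
Proof.
rewrite pcoef_mul big_ord_recl take0 drop0 big1 => [|m _] /=.
  by rewrite andbT addr0; case: eqP => _; rewrite ?mulr1 ?mulr0.
by case: s m => [[]|b s m] //=; rewrite andbF mulr0.
Qed.

Lemma pcoef_peirce i j f v s :
  (pvertex k j * f * pvertex k i) v s =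
    (if (v == i) && (walk_end v s == j) then f v s else 0).
Proof. by rewrite pcoef_mul_vertex pcoef_vertex_mul; case: eqP. Qed.

Lemma pcoef_arrow2 a b v s :
  (parrow k b * parrow k a : kQ) v s =
    ((v == source a) && (target a == source b) && (s == [:: a; b]))%:R.
Proof.
rewrite pcoef_mul; case: s => [|x [|y [|z s]]].
- by rewrite big_ord_recl big_ord0 /= !andbF addr0 mulr0.
- rewrite !big_ord_recl big_ord0 /= !eqseq_cons !andbF /=.
  by rewrite !(mul0r, mulr0, addr0).
- rewrite !big_ord_recl big_ord0 /= !eqseq_cons !andbF !andbT /=.
  rewrite !(mul0r, mulr0, addr0, add0r) -natrM mulnb.
  case: (x =P a) => [->|_]; rewrite ?andbF ?andbT //=.
  by congr (_ %:R); rewrite andbC andbA.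
- rewrite !eqseq_cons !andbF; apply: big1 => -[[|[|m]] hm] _ /=.
  + by rewrite !eqseq_cons /= !andbF mul0r.
  + by rewrite !eqseq_cons /= !andbF mul0r.
  + by rewrite !eqseq_cons /= !andbF mulr0.
Qed.

Program Definition path_deg_part (t : nat) f : kQ :=
  @PathAlg k Q (fun v s => if size s == t then f v s else 0) _ _.
Next Obligation.
move=> t f; have [N hN] := pcoef_fin f; exists N => v s /hN ->.
by rewrite if_same.
Qed.
Next Obligation. by move=> t f v s hs /=; rewrite (pcoef_path f hs) if_same. Qed.

Program Definition path_cut (a : arrow Q) f : kQ :=
  @PathAlg k Q (fun v s => if v == target a then f (source a) (a :: s) else 0) _ _.
Next Obligation.
move=> a f; have [N hN] := pcoef_fin f; exists N => v s hs.
by rewrite hN ?if_same // (leq_trans hs) //= ltnW.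
Qed.
Next Obligation.
move=> a f v s hs /=; case: eqP => // e; rewrite pcoef_path //= eqxx /=.
by rewrite -e.
Qed.

(** The left ideal of positive degree is generated by the arrows: a path of
    positive length is cut after its first arrow. *)
Lemma path_deg_ge1E f : path_deg_ge 1 f ->
  f = \sum_a path_cut a f * parrow k a.
Proof.
move=> hf; apply: path_algP => v s; rewrite pcoef_sum.
case: s => [|b s].
  rewrite (path_deg_ge0 _ hf) // big1 // => a _.
  by rewrite pcoef_mul big_ord_recl big_ord0 /= andbF mulr0 addr0.
rewrite (bigD1 b) // big1 => [|a ab]; last first.
  rewrite pcoef_mul big1 // => -[[|[|m]] hm] _ /=; rewrite ?andbF ?mulr0 //.
    by rewrite eqseq_cons take0 [b == a]eq_sym (negPf ab) andbF mulr0.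
  case: s hm => [|c s] //= _; by rewrite eqseq_cons /= !andbF mulr0.
rewrite [RHS]addr0 pcoef_mul (bigD1 (Ordinal (isT : (1 < (size s).+2)%N))) //=.
rewrite take0 drop0 eqxx /= eqxx andbT big1 => [|[[|[|m]] hm] //= _]; last first.
- case: s hm => [|c s] //= _; by rewrite eqseq_cons /= !andbF mulr0.
- by rewrite andbF mulr0.
rewrite addr0; have [->|vb] := eqVneq v (source b); first by rewrite mulr1.
by rewrite mulr0 pcoef_path //= eq_sym (negPf vb).
Qed.

Program Definition path_deg_ge_ideal (t : nat) : ideal k Q :=
  @Ideal k Q (path_deg_ge t) _ _ _.
Next Obligation. by move=> t v s; rewrite eqxx. Qed.
Next Obligation.
move=> t f g hf hg v s; apply: contraNleq => st /=.
by rewrite (path_deg_ge0 _ hf) // (path_deg_ge0 _ hg) // addr0.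
Qed.
Next Obligation.
move=> t f g h hg v s; have all0 (x : kQ) : path_deg_ge 0 x by [].
have := path_deg_ge_mul (path_deg_ge_mul (all0 f) hg) (all0 h) (v := v) (s := s).
by rewrite addn0.
Qed.

Lemma pcoef_mul_low f g v s : path_deg_ge (size s) g ->
  (f * g) v s = f (walk_end v s) [::] * g v s.
Proof.
move=> hg; rewrite pcoef_mul big_ord_recr drop_size take_size big1 /= ?add0r //.
by move=> m _; rewrite (path_deg_ge0 _ hg) ?mulr0 // size_take ltn_ord.
Qed.

Lemma pcoef_mulr_low f g v s : path_deg_ge (size s) f ->
  (f * g) v s = f v s * g v [::].
Proof.
move=> hf; rewrite pcoef_mul big_ord_recl take0 drop0 big1 ?addr0 //= => m _.
rewrite (path_deg_ge0 _ hf) ?mul0r // size_drop /bump /= add1n.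
by rewrite ltn_subLR ?ltn_ord // addSn ltnS leq_addl.
Qed.

End PathCalculus.

(** * Dimension and growth *)

Section Dimension.
Variables (k : fieldType) (M : lmodType k).
Implicit Types S : set M.

(** While a spanning family has a linear dependency, one of its members can
    be dropped. *)
Lemma has_dim_of_spans S m (b : 'I_m -> M) :
    S = [set x | exists c : 'I_m -> k, x = \sum_i c i *: b i] ->
  exists n, has_dim S n.
Proof.
elim: m b => [|m IH] b hb.
  by exists 0%N, b; split=> // c _ [].
have [ind|] := pselect (forall c : 'I_m.+1 -> k,
  \sum_i c i *: b i = 0 -> forall i, c i = 0); first by exists m.+1, b.
move=> /existsNP[c /not_implyP[c0 /existsNP[i0 /eqP ci0]]].
have bi0 : b i0 = \sum_j (- (c i0)^-1 * c (lift i0 j)) *: b (lift i0 j).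
  have e : c i0 *: b i0 = - \sum_j c (lift i0 j) *: b (lift i0 j).
    by apply/eqP; rewrite -addr_eq0; apply/eqP; rewrite -[RHS]c0 (bigD1_ord i0).
  rewrite -[LHS]scale1r -(mulVf ci0) -scalerA e scalerN scaler_sumr -sumrN.
  by apply: eq_bigr => j _; rewrite scalerA mulNr scaleNr.
apply: (IH (b \o lift i0)); rewrite hb; apply/seteqP; split => x [d ->] /=.
  exists (fun j => d i0 * (- (c i0)^-1 * c (lift i0 j)) + d (lift i0 j)).
  rewrite (bigD1_ord i0) //= {1}bi0 scaler_sumr -big_split /=.
  by apply: eq_bigr => j _; rewrite scalerDl scalerA.
exists (fun i => oapp d 0 (unlift i0 i)).
rewrite (bigD1_ord i0) //= unlift_none scale0r add0r.
by apply: eq_bigr => j _; rewrite liftK.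
Qed.

(** More vectors than the dimension give a coefficient matrix with more rows
    than columns, whose left kernel is a linear dependency. *)
Lemma has_dim_card S n (J : finType) (e : J -> M) : has_dim S n ->
    (forall j, S (e j)) ->
    (forall c : J -> k, \sum_j c j *: e j = 0 -> forall j, c j = 0) ->
  (#|J| <= n)%N.
Proof.
move=> [b [_ hS]] eS ind.
have /choice[A hA] : forall j, exists c : 'I_n -> k, e j = \sum_i c i *: b i.
  by move=> j; have := eS j; rewrite hS.
pose B := \matrix_(j < #|J|, i < n) A (enum_val j) i.
have hB (u : 'rV_#|J|) : u *m B = 0 -> u = 0.
  move=> uB; apply/rowP => j; rewrite mxE -(enum_valK j).
  apply: (ind (fun x => u 0 (enum_rank x))) => //.
  rewrite (reindex (@enum_val J predT)) /=; last exact/onW_bij/enum_val_bij.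
  under eq_bigr do rewrite enum_valK hA scaler_sumr.
  rewrite exchange_big big1 //= => i _.
  under eq_bigr do rewrite scalerA.
  rewrite -scaler_suml; have /rowP/(_ i) := uB.
  rewrite !mxE => e0; rewrite -[RHS](scale0r (b i)); congr (_ *: _).
  by rewrite -[RHS]e0; apply: eq_bigr => l _; rewrite mxE.
have : row_free B.
  rewrite -kermx_eq0; apply/eqP/row_matrixP => j; rewrite row0; apply: hB.
  by rewrite -row_mul mulmx_ker row0.
by move=> /eqP <-; apply: rank_leq_col.
Qed.

End Dimension.

Section Growth.
Variable R : realType.

Lemma limn_esup_lt_pinfty (u : (\bar R)^nat) : (limn_esup u < +oo)%E ->
  exists (B : R) n, forall m, (n <= m)%N -> (u m <= B%:E)%E.
Proof.
rewrite /limn_esup /limf_esup => /ereal_inf_lt[_ [A [n _ An] <-]] hA.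
have [B hB] : exists B : R, (ereal_sup (u @` A) <= B%:E)%E.
  case: (ereal_sup _) hA => [b| |] // _; first by exists b.
  by exists 0; rewrite leNye.
exists B, n => m nm; apply: le_trans hB; apply: ereal_sup_ubound.
by exists m => //; apply: An.
Qed.

(** An exponential lower bound along the multiples of [L] is not a polynomial
    one; the multiples are taken of squares so that only [ln x < x] is used. *)
Lemma limn_esup_exp_growth (d : nat -> nat) (L : nat) : (0 < L)%N ->
    (forall m, (0 < m)%N -> (2 ^ m <= d (m * L))%N) ->
  ~ (limn_esup (fun N => (ln (d N)%:R / ln N%:R : R)%:E) < +oo)%E.
Proof.
move=> L0 hd /limn_esup_lt_pinfty[B [n hB]].
have l2 : 0 < ln (2 : R) by rewrite ln_gt0 // ltr1n.
(* With m = x ^ 2, the logarithm of m L is at most 2 x + ln L, while that of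
   2 ^ m is quadratic in x; any x > C makes the latter win. *)
pose C := `|B| * (2 + ln L%:R) / ln 2.
have lL : 0 <= ln (L%:R : R) by rewrite ln_ge0 // ler1n.
have C0 : 0 <= C by rewrite divr_ge0 ?mulr_ge0 ?addr_ge0 // ltW.
pose x := (n + 2 + Num.bound C)%N.
have x1 : (1 < x)%N by rewrite /x -addnA addnC -addnA.
have x0 : (0 < x)%N by apply: ltnW.
have xC : C < x%:R.
  apply: lt_le_trans (archi_boundP C0) _; rewrite ler_nat leq_addl //.
pose m := (x ^ 2)%N.
have mx : (x <= m)%N by rewrite /m -{1}(expn1 x) leq_pexp2l.
have m0 : (0 < m)%N by apply: leq_trans mx.
have mL1 : (1 < m * L)%N by rewrite (leq_trans x1) // (leq_trans mx) // leq_pmulr.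
have nm : (n <= m * L)%N.
  by rewrite (leq_trans _ (leq_pmulr _ L0)) // (leq_trans _ mx) // /x -addnA leq_addr.
have lmL : 0 < ln ((m * L)%:R : R) by rewrite ln_gt0 // ltr1n.
have := hB _ nm; rewrite lee_fin ler_pdivrMr // leNgt => /negP; apply.
apply: (@lt_le_trans _ _ (ln (2 ^ m)%:R)); last first.
  by rewrite ler_ln ?posrE ?ltr0n ?expn_gt0 ?ler_nat ?hd //
    (leq_trans _ (hd m m0)) // expn_gt0.
rewrite natrX lnXn // -[ln 2 *+ m]mulr_natr.
apply: (@le_lt_trans _ _ (`|B| * (2 + ln L%:R) * x%:R)).
  apply: (@le_trans _ _ (`|B| * ln (m * L)%:R)).
    by rewrite ler_pM2r ?ler_norm.
  rewrite -mulrA ler_wpM2l // natrM lnM ?posrE ?ltr0n // natrX lnXn ?ltr0n //.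
  rewrite mulrDl lerD //.
    by rewrite -[_ *+ 2]mulr_natl ler_wpM2l // ltW // ln_sublinear // ltr0n.
  by rewrite ler_peMr // ler1n.
rewrite /m natrX expr2 mulrA ltr_pM2r ?ltr0n // [ltRHS]mulrC.
by rewrite -ltr_pdivrMr.
Qed.
End Growth.

(** * Exponential growth from rigid cycles *)

Section RigidPaths.
Variables (k : fieldType) (Q : quiver).
Local Notation kQ := (path_alg k Q).
Implicit Types (f g h : kQ) (I : ideal k Q).

Program Definition path_elt (v : vertex Q) (s : seq (arrow Q)) : kQ :=
  @PathAlg k Q (fun w u => [&& w == v, u == s & composable v s]%:R) _ _.
Next Obligation.
move=> v s; exists (size s).+1 => w u su; case: eqP => //= _.
by case: eqP su => // ->; rewrite ltnn.
Qed.
Next Obligation.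
move=> v s w u /=; case: eqP => // ->; case: eqP => // -> /negPf ->.
by rewrite !andbF.
Qed.

Lemma path_elt_deg v s : path_deg (size s) (path_elt v s).
Proof.
by move=> w u /=; rewrite andbCA; case: (u =P s) => [->//|]; rewrite /= eqxx.
Qed.

Lemma quo_lincomb I (J : finType) (c : J -> k) (f : J -> kQ) :
  \sum_j c j *: quo I (f j) = quo I (\sum_j c j *: f j).
Proof.
apply: (big_ind2 (fun x y => x = quo I y)) => [//|x f1 y g1 -> ->|j _].
  exact: quoD.
exact: quoZ.
Qed.

Lemma path_degE t f : path_deg t f ->
  f = \sum_(x : vertex Q * t.-tuple (arrow Q)) f x.1 x.2 *: path_elt x.1 x.2.
Proof.
move=> hf; apply: path_algP => v s; rewrite pcoef_sum.
have [cs|ncs] := boolP (composable v s); last first.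
  rewrite pcoef_path // big1 // => -[w u] _ /=; case: eqP => [<-|_]; rewrite ?mulr0 //.
  by case: eqP => [<-|_]; rewrite ?(negPf ncs) mulr0.
have [st|st] := eqVneq (size s) t; last first.
  rewrite (path_deg0 _ hf) // big1 // => -[w u] _ /=.
  case: (s =P u) => [e|]; last by rewrite andbF mulr0.
  by move: st; rewrite e size_tuple eqxx.
have st' : size s == t by apply/eqP.
rewrite (bigD1 (v, Tuple st')) // big1 /= ?addr0 ?eqxx ?cs ?mulr1 // => -[w u] ne.
case: (v =P w) => [e|]; last by rewrite mulr0.
case: (s =P u) => [e'|]; last by rewrite mulr0.
by case/eqP: ne; congr (_, _); [|apply: val_inj].
Qed.

(** The function [dimk] is only meaningful on finite-dimensional pieces; the
    paths of length t are a finite spanning family. *)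
Lemma alg_deg_has_dim I t : exists n, has_dim (@alg_deg k Q I t) n.
Proof.
pose J := (vertex Q * t.-tuple (arrow Q))%type.
pose b (i : 'I_#|{: J}|) := quo I (path_elt (enum_val i).1 (enum_val i).2).
apply: (@has_dim_of_spans k (bound_alg I) _ _ b).
apply/seteqP; split => x /=.
  move=> [f hf <-]; exists (fun i : 'I_#|{: J}| => f (enum_val i).1 (enum_val i).2).
  rewrite quo_lincomb {1}(path_degE hf) (reindex (@enum_val J predT)) //=.
  exact/onW_bij/enum_val_bij.
move=> [c ->]; rewrite quo_lincomb; eexists; last by [].
move=> v s; rewrite pcoef_sum; apply: contraNeq => st; rewrite big1 // => i _.
by rewrite (_ : (_ *: _ : kQ) v s = c i * path_elt (enum_val i).1 (enum_val i).2 v s)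
  // (path_deg0 _ (@path_elt_deg _ _)) ?mulr0 // size_tuple.
Qed.

Variable D : rel (arrow Q).

(** A relation D on arrows cuts out the D-rigid paths, those whose consecutive
    arrows are all D-related.  They are closed under subpaths, which is why the
    elements without rigid paths form an ideal. *)
Program Definition avoid_ideal : ideal k Q :=
  @Ideal k Q [set f | forall v s, sorted D s -> f v s = 0] _ _ _.
Next Obligation. by []. Qed.
Next Obligation. by move=> f g hf hg v s hs /=; rewrite hf // hg // addr0. Qed.
Next Obligation.
move=> f g h hg v s hs; rewrite pcoef_mul big1 // => m _.
rewrite pcoef_mul big1 ?mul0r // => l _.
by rewrite hg ?mulr0 // take_sorted // drop_sorted.
Qed.

Variable I' : ideal k Q.
Hypothesis I'D : forall f, ideal_set I' f -> forall v s, sorted D s -> f v s = 0.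

(** Reading the coefficients at rigid paths is well defined modulo I', so
    rigid paths stay linearly independent in the quotient. *)
Lemma rigid_paths_dim (J : finType) (v : vertex Q) (w : J -> seq (arrow Q)) t :
    injective w -> (forall j, size (w j) = t) ->
    (forall j, sorted D (w j)) -> (forall j, composable v (w j)) ->
  (#|J| <= dimk (@alg_deg k Q I' t))%N.
Proof.
move=> w_inj wt wD wv; rewrite /dimk; case: xgetP => [n _ hn|no]; last first.
  by have [n hn] := alg_deg_has_dim I' t; case: (no n).
apply: (@has_dim_card _ _ _ n J (fun j => quo I' (path_elt v (w j))) hn) => [j|c].
  by exists (path_elt v (w j)) => //; rewrite -(wt j); apply: path_elt_deg.
rewrite quo_lincomb => /quoP; rewrite subr0 => /I'D h j.
have := h v (w j) (wD j); rewrite pcoef_sum (bigD1 j) //= big1 => [|l lj].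
  by rewrite !eqxx wv mulr1 addr0.
by rewrite eqxx (inj_eq w_inj) eq_sym (negPf lj) mulr0.
Qed.

Hypothesis Dcomp : forall a b, D a b -> target a = source b.

Lemma composable_path a s : path D a s -> composable (source a) (a :: s).
Proof.
rewrite /= eqxx /=; elim: s a => //= b s IH a /andP[/Dcomp ab /IH ->].
by rewrite ab eqxx.
Qed.

(** Rigid cycles through p can be concatenated in any order into rigid paths.
    As both have the same length, such a path determines the word by which it
    was built, and there are 2 ^ m words with m letters. *)
Lemma rigid_cycles_exp_growth p t0 t1 :
    cycle D (p :: t0) -> cycle D (p :: t1) -> size t0 = size t1 -> t0 != t1 ->
  forall m, (2 ^ m <= dimk (@alg_deg k Q I' (m * (size t0).+1)))%N.
Proof.
move=> c0 c1 st t01 m; pose u (b : bool) := if b then t1 else t0.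
have uD b : path D p (rcons (u b) p) by case: b.
have su b : size (u b) = size t0 by case: b.
pose w (x : seq bool) := flatten [seq p :: u b | b <- x].
have wcons b x : w (b :: x) = p :: (u b ++ w x) by [].
have wsize x : size (w x) = (size x * (size t0).+1)%N.
  by elim: x => // b x IH; rewrite wcons /= size_cat IH su mulSn.
have wD x : sorted D (w x).
  case: x => // b x; rewrite wcons /=; elim: x b => [|b' x IH] b.
    by rewrite cats0; have := uD b; rewrite rcons_path => /andP[].
  rewrite wcons -cat_rcons cat_path uD /= last_rcons; exact: IH.
have w_inj : injective w.
  elim=> [|b x IH] [|b' y] //; rewrite !wcons => -[].
  move/eqP; rewrite eqseq_cat ?su // => /andP[/eqP ub /eqP /IH ->].
  by case: b b' ub => -[] //= e; move: t01; rewrite e eqxx.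
have := @rigid_paths_dim (m.-tuple bool) (source p) (fun x => w x)
  (m * (size t0).+1).
rewrite card_tuple card_bool; apply=> [x y /w_inj/val_inj //|x|x|x].
- by rewrite wsize size_tuple.
- exact: wD.
by case: (tval x) (wD x) => // b y; rewrite wcons => /composable_path.
Qed.

Lemma rigid_cycles_GKdim (R : realType) p t0 t1 :
    cycle D (p :: t0) -> cycle D (p :: t1) -> size t0 = size t1 -> t0 != t1 ->
  ~ (GKdim R I' < +oo)%E.
Proof.
move=> c0 c1 st t01.
have growth := rigid_cycles_exp_growth c0 c1 st t01.
apply: (@limn_esup_exp_growth R
  (fun N => \sum_(1 <= t < N.+1) dimk (@alg_deg k Q I' t))%N (size t0).+1) => // m m0.
rewrite big_nat_recr ?muln_gt0 ?m0 //= (leq_trans (growth m)) // leq_addl //.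
Qed.

End RigidPaths.

(** * Degree two of an algebra with socle in degree three *)

Section FromTo.
Variables (k : fieldType) (Q : quiver).
Local Notation kQ := (path_alg k Q).
Implicit Types (f g h : kQ) (i j l : vertex Q).

Definition from_to i j f := f = pvertex k j * f * pvertex k i.

Lemma pcoef_from_to i j f v s : from_to i j f ->
  f v s = if (v == i) && (walk_end v s == j) then f v s else 0.
Proof. by move=> {1}->; rewrite pcoef_peirce. Qed.

Lemma from_to_support i j f v s : from_to i j f -> f v s != 0 ->
  [/\ v = i, walk_end v s = j & composable v s].
Proof.
move=> hf; rewrite (pcoef_from_to v s hf).
case: ifP => [/andP[/eqP-> /eqP->] fv|_]; last by rewrite eqxx.
by split=> //; apply: contraNT fv => /(pcoef_path f) ->.
Qed.

Lemma from_toP i j f :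
  (forall v s, f v s != 0 -> v = i /\ walk_end v s = j) -> from_to i j f.
Proof.
move=> h; apply: path_algP => v s; rewrite pcoef_peirce.
by have [->|/h[-> ->]] := eqVneq (f v s) 0; rewrite ?if_same ?eqxx.
Qed.

Lemma peirce_from_to i j f : from_to i j (pvertex k j * f * pvertex k i).
Proof.
apply: from_toP => v s; rewrite pcoef_peirce.
by case: ifP => [/andP[/eqP-> /eqP->]|_]; rewrite ?eqxx.
Qed.

Lemma from_to_vertex i j f l :
  from_to i j f -> pvertex k l * f = if l == j then f else 0.
Proof.
move=> hf; apply: path_algP => v s; rewrite pcoef_vertex_mul.
have [f0|/(from_to_support hf)[_ -> _]] := eqVneq (f v s) 0.
  by rewrite f0 if_same; case: ifP.
by rewrite eq_sym; case: ifP.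
Qed.

Lemma from_to_source i j f : from_to i j f -> f * pvertex k i = f.
Proof.
move=> hf; apply: path_algP => v s; rewrite pcoef_mul_vertex.
have [f0|/(from_to_support hf)[-> _ _]] := eqVneq (f v s) 0.
  by rewrite f0 if_same.
by rewrite eqxx.
Qed.

Lemma from_to_mul i j l f g : from_to i j f -> from_to j l g -> from_to i l (g * f).
Proof.
move=> hf hg; rewrite /from_to mulrA (from_to_vertex l hg) eqxx -mulrA.
by rewrite (from_to_source hf).
Qed.

Lemma from_toB i j f g : from_to i j f -> from_to i j g -> from_to i j (f - g).
Proof. by move=> hf hg; rewrite /from_to mulrBr mulrBl -hf -hg. Qed.

Lemma from_toD i j f g : from_to i j f -> from_to i j g -> from_to i j (f + g).
Proof. by move=> hf hg; rewrite /from_to mulrDr mulrDl -hf -hg. Qed.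

Lemma from_toZ i j (c : k) f : from_to i j f -> from_to i j (c *: f).
Proof.
by move=> hf; rewrite /from_to -path_alg_scalerAr -path_alg_scalerAl -hf.
Qed.

Lemma from_to_arrow a : from_to (source a) (target a) (parrow k a : kQ).
Proof.
apply: from_toP => v s /=; case: (v =P source a) => [->|]; last by rewrite eqxx.
by case: (s =P [:: a]) => [->|]; rewrite ?eqxx.
Qed.

Lemma parrow_mul0 i j f a : from_to i j f -> source a != j -> parrow k a * f = 0.
Proof.
move=> hf aj; rewrite -(from_to_source (from_to_arrow a)) -mulrA.
by rewrite (from_to_vertex _ hf) (negPf aj) mulr0.
Qed.

Lemma path_degB t f g : path_deg t f -> path_deg t g -> path_deg t (f - g).
Proof.
move=> hf hg v s; apply: contraNeq => st.
by rewrite (_ : (f - g) v s = f v s - g v s) //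
  (path_deg0 _ hf) // (path_deg0 _ hg) ?subr0.
Qed.

Lemma path_degD t f g : path_deg t f -> path_deg t g -> path_deg t (f + g).
Proof.
move=> hf hg v s; apply: contraNeq => st.
by rewrite (_ : (f + g) v s = f v s + g v s) //
  (path_deg0 _ hf) // (path_deg0 _ hg) ?addr0.
Qed.

Lemma path_degZ t (c : k) f : path_deg t f -> path_deg t (c *: f).
Proof.
move=> hf v s; apply: contraNeq => st.
by rewrite (_ : (c *: f) v s = c * f v s) // (path_deg0 _ hf) // mulr0.
Qed.

Lemma path_deg_arrow2 a b : path_deg 2 (parrow k b * parrow k a : kQ).
Proof. exact: (path_deg_mul (@parrow_deg k Q b) (@parrow_deg k Q a)). Qed.

Lemma from_to_arrow2 a b : target a = source b ->
  from_to (source a) (target b) (parrow k b * parrow k a : kQ).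
Proof.
by move=> ab; apply: (from_to_mul (from_to_arrow a)); rewrite ab; apply: from_to_arrow.
Qed.

End FromTo.

Section Frobenius.
Variables (k : fieldType) (Q : quiver) (rho : set (path_alg k Q)).
Local Notation kQ := (path_alg k Q).
Local Notation I := (ideal_gen rho).
Local Notation inI f := (ideal_set I f).
Implicit Types (f g h : kQ) (i j l : vertex Q).

Hypothesis rho2 : rho `<=` path_deg 2.
Hypothesis trivI : trivial_stable_translation 2 I.
Hypothesis out_arrow : forall i : vertex Q, exists a, source a = i.
Hypothesis no_short_cycle : forall (v : vertex Q) s,
  composable v s -> walk_end v s = v -> (size s == 0%N) || (2 < size s)%N.

Lemma relations_deg_ge2 f : inI f -> path_deg_ge 2 f.
Proof.
move=> /(@ideal_gen_min _ _ rho (@path_deg_ge_ideal k Q 2)); apply.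
by move=> g /rho2/path_degW.
Qed.

Lemma relations_deg_ge4 f : path_deg_ge 4 f -> inI f.
Proof.
move=> hf; have [_ _ loewy _] := trivI.
rewrite -[f]subr0; apply/quoP.
by apply: ((loewy 4%N).2 isT); exists f.
Qed.

Lemma arrow_not_relation (a : arrow Q) : ~ inI (parrow k a).
Proof.
move=> /relations_deg_ge2/(_ (source a) [:: a]) /=.
by rewrite !eqxx oner_eq0 => /(_ isT).
Qed.

Lemma relation_of_arrows f g :
  (forall a, inI (parrow k a * f)) -> path_deg_ge 1 g -> inI (g * f).
Proof.
move=> h /path_deg_ge1E ->; rewrite mulr_suml; apply: ideal_sum => a _.
by rewrite -mulrA; apply: ideal_mull.
Qed.

(** The socle of L e_i is spanned by an element x fixed by e_i on both sides,
    so by closed paths at i, which have length 0, length 3, or length at least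
    4 and then vanish in L.  The component c e_i of degree 0 vanishes because
    an arrow starting at i kills x without vanishing in L itself.  So x is
    homogeneous of degree 3. *)
Lemma socle_generator i : exists y : kQ, [/\ from_to i i y, path_deg 3 y &
  forall f, f = f * pvertex k i -> (forall a, inI (parrow k a * f)) ->
    exists c : k, inI (f - c *: y)].
Proof.
have [_ _ _ [_ /(_ i)[x [x0 xi socx]]]] := trivI.
have xsoc : socle i x by rewrite socx; exists 1; rewrite ?scale1r.
have [X [Xx Xii]] : exists X, quo I X = x /\ from_to i i X.
  exists (pvertex k i * repr x * pvertex k i); split; last exact: peirce_from_to.
  rewrite -quoM -quoM quo_repr; have [xe _] := xsoc.
  exact: (etrans (congr1 (fun z => z * quo I (pvertex k i)) xi) (esym xe)).
pose y := path_deg_part 3 X.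
have yii : from_to i i y.
  apply: from_toP => v s /=; case: ifP => _; last by rewrite eqxx.
  by move=> /(from_to_support Xii)[].
have y3 : path_deg 3 y by move=> v s /=; case: ifP => [/eqP //|_]; rewrite eqxx.
pose c := X i [::].
have Xy : inI (X - (c *: pvertex k i + y)).
  apply: relations_deg_ge4 => v s; apply: contraNleq; rewrite ltnS => s3.
  rewrite (_ : (_ - _ : kQ) v s = X v s - (c * ((v == i) && (s == [::]))%:R +
    (if size s == 3%N then X v s else 0))) //.
  have [Xv0|] := eqVneq (X v s) 0.
    rewrite Xv0 if_same addr0 sub0r oppr_eq0.
    case: (v =P i) => [vi|_]; last by rewrite mulr0.
    case: (s =P [::]) => [si|_]; last by rewrite mulr0.
    by rewrite /c -vi -si Xv0 mul0r.
  move=> /(from_to_support Xii)[vi wi cvs]; subst v.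
  case/orP: (no_short_cycle cvs wi) => [/nilP->|s2] /=.
    by rewrite eqxx mulr1 addr0 subrr.
  have -> : size s == 3%N by rewrite eqn_leq s3.
  by case: s s2 {s3 wi cvs} => // b s _; rewrite andbF mulr0 add0r subrr.
have c0 : c = 0.
  have [a ai] := out_arrow i.
  have : inI (parrow k a * (c *: pvertex k i)).
    rewrite (_ : parrow k a * _ = parrow k a * X -
      parrow k a * (X - (c *: pvertex k i + y)) - parrow k a * y).
      apply: idealB; last first.
        exact/relations_deg_ge4/path_degW/(path_deg_mul (@parrow_deg k Q a) y3).
      apply: idealB; last exact: ideal_mull.
      rewrite -[X in ideal_set _ X]subr0; apply/quoP; rewrite -quoM Xx.
      case: xsoc => _; apply; exists (parrow k a) => //.
      exact/path_degW/parrow_deg.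
    by rewrite -!mulrBr subKr addrK.
  move=> /relations_deg_ge2/(@path_deg_ge0 _ _ _ _ i [:: a])/(_ isT).
  rewrite -path_alg_scalerAr -ai (from_to_source (from_to_arrow _ _)) /=.
  by rewrite !eqxx mulr1.
exists y; split=> // f fi hf.
have fsoc : socle i (quo I f).
  split; first by rewrite [RHS](quoM I) -fi.
  move=> _ [g g1 <-]; rewrite [LHS](quoM I); apply/quoP; rewrite subr0.
  exact: relation_of_arrows.
move: fsoc; rewrite socx => -[d _]; rewrite -Xx [_ *: _](quoZ I) => /quoP dX.
exists d; rewrite (_ : f - _ = d *: (X - (c *: pvertex k i + y)) - (d *: X - f)).
  by apply: idealB => //; apply: ideal_scale.
by rewrite c0 scale0r add0r scalerBr opprB [RHS]addrC addrA subrK.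
Qed.

Lemma no_short_from_to i f n :
  (0 < n < 3)%N -> path_deg n f -> from_to i i f -> f = 0.
Proof.
move=> n3 fn fi; apply: path_algP => v s; apply/eqP; apply: contraLR n3 => fv.
have [vi wi cvs] := from_to_support fi fv; subst v.
rewrite -(fn _ _ fv); have := no_short_cycle cvs wi.
by case: (size s) => [|[|[|]]].
Qed.

Lemma from_to_socle0 i l y : from_to i i y -> l != i -> pvertex k l * y = 0.
Proof. by move=> hy li; rewrite (from_to_vertex _ hy) (negPf li). Qed.

(** Degree 3 lies in the socle, which only contains closed paths. *)
Lemma relation_deg3 i l f : from_to i l f -> path_deg 3 f -> l != i -> inI f.
Proof.
move=> fil f3 li; have [y [yi _ /(_ f)]] := socle_generator i.
case=> [|a|c]; first by rewrite (from_to_source fil).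
  exact/relations_deg_ge4/path_degW/(path_deg_mul (@parrow_deg k Q a) f3).
move/(ideal_mull (pvertex k l)); rewrite mulrBr (from_to_vertex _ fil) eqxx.
by rewrite -path_alg_scalerAr (from_to_socle0 yi li) scaler0 subr0.
Qed.

(** Otherwise f would be in the socle of L e_i, which is concentrated at the
    vertex i, whereas j differs from i for lack of closed paths of length 2. *)
Lemma detecting_arrow i j f : from_to i j f -> path_deg 2 f -> ~ inI f ->
  exists a, [/\ source a = j, target a = i & ~ inI (parrow k a * f)].
Proof.
move=> fij f2 nIf.
have ji : j != i.
  apply: contra_notN nIf => /eqP ji; subst j.
  by rewrite (@no_short_from_to i f 2) //; apply: ideal0.
have [a nIa] : exists a, ~ inI (parrow k a * f).
  apply/not_existsP => h; apply: nIf.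
  have [y [yi _ /(_ f)]] := socle_generator i.
  case=> [|a|c]; [by rewrite (from_to_source fij) | exact: contrapT|].
  move/(ideal_mull (pvertex k j)); rewrite mulrBr (from_to_vertex _ fij) eqxx.
  by rewrite -path_alg_scalerAr (from_to_socle0 yi ji) scaler0 subr0.
have aj : source a = j.
  apply/eqP; apply: contra_notT nIa => aj; rewrite (parrow_mul0 fij aj).
  exact: ideal0.
exists a; split=> //; apply/eqP; apply: contra_notT nIa => ai.
apply: relation_deg3 ai; last exact: (path_deg_mul (@parrow_deg k Q a) f2).
by apply: from_to_mul fij _; rewrite -aj; apply: from_to_arrow.
Qed.

(** A path of length 2 that does not vanish in L is detected by an arrow, which
    closes it up to a triangle. *)
Lemma relation_no_arrow a b : target a = source b ->
    (forall c, source c = target b -> target c <> source a) ->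
  inI (parrow k b * parrow k a).
Proof.
move=> ab h; apply: contrapT.
have fab := from_to_arrow2 k ab.
by case/(detecting_arrow fab (@path_deg_arrow2 k Q a b)) => c [/h].
Qed.

(** Multiplication by the only arrow a from j to i maps e_j L_2 e_i into the
    line e_i L_3 e_i, and it is injective since only a can detect anything. *)
Lemma deg2_le1 i j f g :
    (forall a b : arrow Q, source a = source b -> target a = target b -> a = b) ->
    from_to i j f -> path_deg 2 f -> from_to i j g -> path_deg 2 g -> ~ inI f ->
  exists c : k, inI (g - c *: f).
Proof.
move=> par fij f2 gij g2 nIf.
have [a [aj ai nIaf]] := detecting_arrow fij f2 nIf.
have [y [yi _ hy]] := socle_generator i.
have aline h : from_to i j h -> path_deg 2 h ->
    exists c : k, inI (parrow k a * h - c *: y).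
  move=> hij h2; apply: hy; first by rewrite -mulrA (from_to_source hij).
  move=> b; apply/relations_deg_ge4/path_degW.
  exact/(path_deg_mul (@parrow_deg k Q b))/(path_deg_mul (@parrow_deg k Q a) h2).
have [l hl] := aline f fij f2; have [m hm] := aline g gij g2.
have l0 : l != 0.
  by apply: contra_notN nIaf => /eqP l0; move: hl; rewrite l0 scale0r subr0.
exists (m / l); apply: contrapT => nIh.
have hij : from_to i j (g - (m / l) *: f) by apply/from_toB/from_toZ.
have h2 : path_deg 2 (g - (m / l) *: f) by apply/path_degB/path_degZ.
have [b [bj bi]] := detecting_arrow hij h2 nIh.
have -> : b = a by apply: par; rewrite ?bj ?bi.
apply; rewrite (_ : _ * _ = (parrow k a * g - m *: y) -
  (m / l) *: (parrow k a * f - l *: y)).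
  by apply: idealB => //; apply: ideal_scale.
rewrite mulrBr -path_alg_scalerAr scalerBr scalerA divfK // opprB.
by rewrite addrA subrK.
Qed.

(** An arrow is not in the socle, so it extends to a nonzero path of length 2,
    which a third arrow detects. *)
Lemma arrow_completes a : exists b c,
  [/\ target a = source b, target b = source c, target c = source a &
      ~ inI (parrow k c * parrow k b * parrow k a)].
Proof.
have ft := from_to_arrow k a.
have ta : target a != source a.
  apply: contra_notN (@arrow_not_relation a) => /eqP e.
  rewrite (@no_short_from_to (source a) (parrow k a) 1) //.
  - exact: ideal0.
  - exact: parrow_deg.
  - by rewrite -{2}e.
have [b nIb] : exists b, ~ inI (parrow k b * parrow k a).
  apply/not_existsP => h; apply: (@arrow_not_relation a).
  have [y [yi _ /(_ (parrow k a))]] := socle_generator (source a).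
  case=> [|b|c]; [by rewrite (from_to_source ft) | exact: contrapT|].
  move/(ideal_mull (pvertex k (target a))); rewrite mulrBr (from_to_vertex _ ft) eqxx.
  by rewrite -path_alg_scalerAr (from_to_socle0 yi ta) scaler0 subr0.
have ab : target a = source b.
  apply/eqP; apply: contra_notT nIb => ab.
  by rewrite (parrow_mul0 ft) 1?eq_sym //; apply: ideal0.
have [c [cb ca nI]] :=
  detecting_arrow (from_to_arrow2 k ab) (@path_deg_arrow2 k Q a b) nIb.
by exists b, c; split; rewrite -?mulrA.
Qed.

(** If r q were nonzero, it would span the line of L_2 from the target of p
    to its source.  Since q p = 0, right multiplication by p would vanish on
    this line, and p could not be completed to a nonzero cycle of length 3. *)
Lemma relation_rotate p q r :
    (forall a b : arrow Q, source a = source b -> target a = target b -> a = b) ->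
    target p = source q -> target q = source r -> target r = source p ->
  inI (parrow k q * parrow k p) -> inI (parrow k r * parrow k q).
Proof.
move=> par pq qr rp Iqp; apply: contrapT => nIrq.
have [b [c [pb bc cp nI]]] := arrow_completes p; apply: nI.
have f1 := from_to_arrow2 k qr; have f2 := from_to_arrow2 k bc.
rewrite -pq rp in f1; rewrite -pb cp in f2.
have [d hd] := deg2_le1 par f1 (@path_deg_arrow2 k Q q r) f2
  (@path_deg_arrow2 k Q b c) nIrq.
rewrite (_ : _ * _ = (parrow k c * parrow k b - d *: (parrow k r * parrow k q : kQ)) *
  parrow k p + d *: (parrow k r * (parrow k q * parrow k p) : kQ)).
  by apply: idealD; [apply: ideal_mulr | apply/ideal_scale/ideal_mull].
by rewrite mulrBl -path_alg_scalerAl mulrA subrK.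
Qed.

End Frobenius.

(** * Orthogonal relations *)

Section QuadraticDual.
Variables (k : fieldType) (Q : quiver).
Local Notation kQ := (path_alg k Q).
Implicit Types (f g h : kQ) (i j l : vertex Q).

Lemma pair2C f g : pair2 f g = pair2 g f.
Proof. by apply: eq_bigr => v _; apply: eq_bigr => s _; rewrite mulrC. Qed.

Lemma pair2Dr f g h : pair2 f (g + h) = pair2 f g + pair2 f h.
Proof.
rewrite -big_split; apply: eq_bigr => v _; rewrite -big_split.
by apply: eq_bigr => s _; rewrite mulrDr.
Qed.

Lemma pair2Zr (c : k) f g : pair2 f (c *: g) = c * pair2 f g.
Proof.
rewrite mulr_sumr; apply: eq_bigr => v _; rewrite mulr_sumr.
by apply: eq_bigr => s _; rewrite mulrCA.
Qed.

Lemma pair2_arrow2 f a b : target a = source b ->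
  pair2 f (parrow k b * parrow k a) = f (source a) [:: a; b].
Proof.
move=> ab; have := @pcoef_arrow2 k Q a b; rewrite ab eqxx; move: (_ * _) => u uE.
rewrite /pair2 (bigD1 (source a)) //= [X in _ + X]big1 => [|v va]; last first.
  by apply: big1 => s _; rewrite uE (negPf va) mulr0.
rewrite addr0 (bigD1 [tuple a; b]) //= big1 => [|s sab].
  by rewrite addr0 uE !eqxx mulr1.
by rewrite uE (_ : (tval s == [:: a; b]) = false) ?andbF ?mulr0 //; apply/negbTE.
Qed.

Variable rho : set kQ.
Hypothesis rho2 : rho `<=` path_deg 2.

(** Orthogonality to a dual relation f passes from rho to the ideal it
    generates: f lives between two fixed vertices, so multiplying h by elements
    of the path algebra only rescales the degree 2 part seen by f. *)
Program Definition orthogonal_ideal : ideal k Q :=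
  @Ideal k Q [set h | path_deg_ge 2 h /\ forall f, quad_perp rho f -> pair2 f h = 0] _ _ _.
Next Obligation.
split=> [v s|f _]; first by rewrite eqxx.
by apply: big1 => v _; apply: big1 => s _; rewrite mulr0.
Qed.
Next Obligation.
move=> g h [g2 hg] [h2 hh]; split; first exact: (@idealD _ _ (path_deg_ge_ideal k Q 2)).
by move=> f hf; rewrite pair2Dr hg // hh // addr0.
Qed.
Next Obligation.
move=> x h y [h2 hh]; split; first exact: (@idealM _ _ (path_deg_ge_ideal k Q 2)).
move=> f hf; have [[i [j [_ fij]]] _] := hf.
transitivity (x j [::] * y i [::] * pair2 f h); last by rewrite hh ?mulr0.
rewrite mulr_sumr; apply: eq_bigr => v _; rewrite mulr_sumr; apply: eq_bigr => s _.
have [->|/(from_to_support fij)[-> we _]] := eqVneq (f v s) 0.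
  by rewrite !mul0r mulr0.
have xh2 : path_deg_ge 2 (x * h) by apply: (@ideal_mull _ _ (path_deg_ge_ideal k Q 2)).
rewrite pcoef_mulr_low ?size_tuple // pcoef_mul_low ?size_tuple // -we.
rewrite mulrC -!mulrA; congr (_ * _); rewrite mulrCA; congr (_ * _); exact: mulrC.
Qed.

Lemma quad_perp_ortho f h :
  quad_perp rho f -> ideal_set (ideal_gen rho) h -> pair2 f h = 0.
Proof.
move=> hf /(@ideal_gen_min _ _ _ orthogonal_ideal); case=> [g rg|_]; last exact.
split; first exact/path_degW/rho2.
by move=> f' [_]; apply.
Qed.

(** The coefficient of f at a path of length 2 is its pairing with that path. *)
Lemma quad_perp_coef0 f v a b : quad_perp rho f ->
  ideal_set (ideal_gen rho) (parrow k b * parrow k a) -> f v [:: a; b] = 0.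
Proof.
move=> hf Iba; have [cab|/pcoef_path->//] := boolP (composable v [:: a; b]).
move: cab => /= /and3P[/eqP <- /eqP ab _].
by rewrite -(pair2_arrow2 _ (esym ab)); apply: quad_perp_ortho.
Qed.

(** Modulo u' - c u, every combination of u and u' is a multiple of u, and u
    is not a relation.  So the relations between u and u' form the line of
    u' - c u, which is orthogonal to u + c u'. *)
Lemma quad_perp_square i j p q p' q' (c : k) :
    source p = i -> target p = source q -> target q = j ->
    source p' = i -> target p' = source q' -> target q' = j ->
    [:: p; q] != [:: p'; q'] ->
    (forall a b, source a = i -> target a = source b -> target b = j ->
      [:: a; b] = [:: p; q] \/ [:: a; b] = [:: p'; q']) ->
    let u := parrow k q * parrow k p : kQ in
    let u' := parrow k q' * parrow k p' : kQ in
    ~ ideal_set (ideal_gen rho) u -> ideal_set (ideal_gen rho) (u' - c *: u) ->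
  forall f, path_deg 2 f -> from_to i j f ->
    (quad_perp rho f <-> exists t : k, f = t *: (u + c *: u')).
Proof.
move=> pi pq qj pi' pq' qj' ne only u u' nIu Iuu' f f2 fij.
have uE v s : u v s = ((v == i) && (s == [:: p; q]))%:R.
  by rewrite pcoef_arrow2 pi pq eqxx andbT.
have uE' v s : u' v s = ((v == i) && (s == [:: p'; q']))%:R.
  by rewrite pcoef_arrow2 pi' pq' eqxx andbT.
have expand g : path_deg 2 g -> from_to i j g ->
    g = g i [:: p; q] *: u + g i [:: p'; q'] *: u'.
  move=> g2 gij; apply: path_algP => v s.
  rewrite (_ : (_ + _ : kQ) v s = g i [:: p; q] * u v s + g i [:: p'; q'] * u' v s) //.
  rewrite uE uE'; have [gv|] := eqVneq (g v s) 0.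
    case: (v =P i) gv => [->|_ ->]; last by rewrite !mulr0 addr0.
    case: (s =P [:: p; q]) => [->|_] gv.
      by rewrite (negPf ne) mulr0 addr0 mulr1.
    by case: (s =P [:: p'; q']) gv => [->|_] ->; rewrite !(mulr0, mul0r) addr0.
  move=> gv; have [-> we /=] := from_to_support gij gv; rewrite eqxx /=.
  have := g2 _ _ gv; case: s we gv => [|a [|b []]] //= bj gv _.
  case/and3P=> /eqP ai /eqP ab _; case: (only a b ai (esym ab) bj) => -[-> ->].
    by rewrite eqxx (negPf ne) mulr1 mulr0 addr0.
  by rewrite eqxx eq_sym (negPf ne) mulr1 mulr0 add0r.
split=> [hf|[t ft]].
  have := quad_perp_ortho hf Iuu'.
  rewrite -scaleNr pair2Dr pair2Zr !pair2_arrow2 // pi pi' mulNr => /subr0_eq fpq.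
  exists (f i [:: p; q]); rewrite {1}(expand f f2 fij) fpq scalerDr scalerA.
  by rewrite mulrC.
split; first by exists i, j.
move=> g rg; rewrite pair2C ft pair2Zr pair2Dr pair2Zr !pair2_arrow2 // pi pi'.
set x := g i [:: p; q]; set y := g i [:: p'; q'].
pose h := pvertex k j * g * pvertex k i.
have hE v s : h v s = if (v == i) && (walk_end v s == j) then g v s else 0.
  exact: pcoef_peirce.
have h2 : path_deg 2 h.
  move=> v s; rewrite hE; case: ifP => _; first exact: (rho2 rg).
  by rewrite eqxx.
have hx : h i [:: p; q] = x by rewrite hE /= qj !eqxx.
have hy : h i [:: p'; q'] = y by rewrite hE /= qj' !eqxx.
have Ih : ideal_set (ideal_gen rho) h by apply/idealM/sub_ideal_gen.
rewrite (_ : x + _ = 0) ?mulr0 //; apply/eqP; apply: contra_notT nIu => xy0.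
rewrite -[u]scale1r -(mulVf xy0) -scalerA; apply: ideal_scale.
rewrite (_ : _ *: u = h - y *: (u' - c *: u)).
  by apply: idealB => //; apply: ideal_scale.
rewrite (expand h h2) ?hx ?hy; last exact: peirce_from_to.
by rewrite scalerBr opprB scalerA addrACA subrr addr0 scalerDl [c * y]mulrC.
Qed.

End QuadraticDual.

(** * The McKay quiver *)

Lemma intr_Zp_eq0 n (m : int) : (4 <= n)%N -> (`|m| < 4)%N ->
  (m%:~R == 0 :> 'Z_n) = (m == 0).
Proof.
move=> n4 m4; have n1 : (1 < n)%N by apply: leq_trans n4.
have nat_eq0 j : (j < 4)%N -> (j%:R == 0 :> 'Z_n) = (j == 0)%N.
  move=> j4; rewrite -val_eqE /= val_Zp_nat // modn_small //.
  exact: leq_trans j4 n4.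
case: m m4 => j j4; first by rewrite -pmulrn nat_eq0.
by rewrite NegzE mulrNz oppr_eq0 -pmulrn nat_eq0.
Qed.

(** The three types alpha, beta and gamma of arrows. *)
Inductive dir := DirA | DirB | DirC.

Section McKay.
Variables (s r : nat).
Hypotheses (s4 : (4 <= s)%N) (r4 : (4 <= r)%N).
Local Notation Q := (mckay s r).
Local Notation V := (mvertex s r).
Implicit Types (i j : V) (x y z : dir).

Definition step x : V :=
  match x with
  | DirA => e1 s r
  | DirB => e2 s r
  | DirC => - (e1 s r + e2 s r)
  end.

Definition marr x i : arrow Q :=
  match x with DirA => inl (inl i) | DirB => inl (inr i) | DirC => inr i end.

Lemma marrP (a : arrow Q) : exists x i, a = marr x i.
Proof.
by case: a => [[i|i]|i]; [exists DirA, i | exists DirB, i | exists DirC, i].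
Qed.

Lemma source_marr x i : source (marr x i) = i. Proof. by case: x. Qed.
Lemma target_marr x i : target (marr x i) = i + step x. Proof. by case: x. Qed.

Lemma marr_dir x y i j : marr x i = marr y j -> x = y.
Proof. by case: x; case: y. Qed.

(** Steps of the quiver are lifted to integer vectors.  The combinations of
    steps compared below have entries of absolute value less than 4, and such a
    vector vanishes modulo s and r only if it is zero. *)
Definition zvec (m n : int) : V := (m%:~R, n%:~R).

Lemma zvecD m n m' n' : zvec m n + zvec m' n' = zvec (m + m') (n + n').
Proof. by rewrite /zvec !intrD. Qed.

Lemma zvecN m n : - zvec m n = zvec (- m) (- n).
Proof. by rewrite /zvec !mulrNz. Qed.

Lemma zvec_eq0 m n : zvec m n = 0 ->
  (`|m| < 4)%N && (`|n| < 4)%N ==> (m == 0) && (n == 0).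
Proof.
case=> /eqP hm /eqP hn; apply/implyP => /andP[m4 n4].
by rewrite -(intr_Zp_eq0 s4 m4) hm -(intr_Zp_eq0 r4 n4) hn.
Qed.

Lemma stepE x : step x =
  match x with DirA => zvec 1 0 | DirB => zvec 0 1 | DirC => zvec (-1) (-1) end.
Proof.
have eA : e1 s r = zvec 1 0 by [].
have eB : e2 s r = zvec 0 1 by [].
by case: x; rewrite /= ?eA ?eB // zvecD zvecN.
Qed.

Lemma step_eq0 x : step x <> 0.
Proof. by rewrite stepE; case: x => /zvec_eq0. Qed.

Lemma step2_eq0 x y : step x + step y <> 0.
Proof. by rewrite !stepE; case: x; case: y; rewrite zvecD => /zvec_eq0. Qed.

(** No arrow closes up a path made of two arrows of the same type. *)
Lemma step2D_eq0 x y : step x + step x + step y <> 0.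
Proof. by rewrite !stepE; case: x; case: y; rewrite !zvecD => /zvec_eq0. Qed.

Lemma step_inj : injective step.
Proof.
move=> x y /eqP; rewrite -subr_eq0 !stepE => /eqP.
by case: x; case: y => //; rewrite zvecN zvecD => /zvec_eq0.
Qed.

Lemma step2_inj x y x' y' : x <> y -> step x' + step y' = step x + step y ->
  x' = x /\ y' = y \/ x' = y /\ y' = x.
Proof.
move=> xy /eqP; rewrite -subr_eq0 !stepE => /eqP.
case: x xy; case: y => // _; case: x'; case: y'; try by auto.
all: by rewrite !(zvecD, zvecN) => /zvec_eq0.
Qed.

Lemma mckay_parallel (a b : arrow Q) :
  source a = source b -> target a = target b -> a = b.
Proof.
have [x [i ->]] := marrP a; have [y [j ->]] := marrP b.
by rewrite !source_marr !target_marr => -> /addrI/step_inj ->.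
Qed.

Lemma mckay_no_short_cycle (v : vertex Q) p :
  composable v p -> walk_end v p = v -> (size p == 0%N) || (2 < size p)%N.
Proof.
case: p => [|a [|b [|c p]]] //; cbn [composable walk_end].
  have [x [i ->]] := marrP a; rewrite source_marr target_marr.
  move=> /andP[/eqP -> _] ix; case: (@step_eq0 x); apply: (@addrI _ v).
  by rewrite addr0.
have [x [i ->]] := marrP a; have [y [j ->]] := marrP b.
rewrite !source_marr !target_marr => /and3P[/eqP -> /eqP -> _] ixy.
by case: (@step2_eq0 x y); apply: (@addrI _ v); rewrite addr0 addrA.
Qed.

Lemma mckay_out_arrow (i : vertex Q) : exists a : arrow Q, source a = i.
Proof. by exists (marr DirA i); rewrite source_marr. Qed.

Lemma mulrn_period i : i *+ (s * r) = 0.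
Proof.
have Zp_period n m (u : 'Z_n) : (4 <= n)%N -> u *+ (n * m) = 0.
  move=> n4; rewrite mulrnA -[u *+ n]mulr_natl pchar_Zp ?mul0r ?mul0rn //.
  exact: leq_trans n4.
have eq0 u w : (u, w) *+ (s * r) = (u *+ (s * r), w *+ (s * r)) :> V.
  by elim: (s * r)%N => // n IH; rewrite !mulrS IH.
by case: i => u w; rewrite eq0 Zp_period // mulnC Zp_period.
Qed.

Section Growth.
Variable D : rel (arrow Q).
Hypothesis Dline : forall x i, D (marr x i) (marr x (i + step x)).

Definition line x i n := [seq marr x (i + step x *+ m) | m <- iota 1 n].

Lemma line_path x i n : path D (marr x i) (line x i n).
Proof.
rewrite -[in marr x i](addr0 i) -[0](mulr0n (step x)) /line.
elim: n 0%N => //= n IH m; rewrite IH andbT.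
by rewrite -[m.+1]addn1 mulrnDr mulr1n addrA.
Qed.

Lemma last_line x i n : last (marr x i) (line x i n) = marr x (i + step x *+ n).
Proof.
case: n => [|n]; first by rewrite mulr0n addr0.
by rewrite /line -[X in iota _ X]addn1 iotaD map_cat last_cat /= add1n.
Qed.

Lemma cycle_cat (T : Type) (E : rel T) p t u :
  cycle E (p :: t) -> cycle E (p :: u) -> cycle E (p :: (t ++ p :: u)).
Proof.
move=> /= ct cu; rewrite rcons_cat rcons_cons -cat_rcons cat_path ct.
by rewrite last_rcons.
Qed.

Variables (k : fieldType) (I' : ideal k Q).
Hypothesis I'D : forall f, ideal_set I' f -> forall v u, sorted D u -> f v u = 0.
Hypothesis Dcomp : forall a b, D a b -> target a = source b.

(** Let p, q, t be the sides of the triangle and l the line of arrows that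
    leads from q back to q.  The cycles p, q, t and p, q, l, t can be
    concatenated in two orders, which gives two rigid cycles of equal length;
    they differ at their third arrow. *)
Lemma rigid_triangle_GKdim (R : realType) (i : V) x y z :
    y <> z ->
    D (marr x i) (marr y (i + step x)) ->
    D (marr y (i + step x)) (marr z (i + step x + step y)) ->
    D (marr z (i + step x + step y)) (marr x i) ->
  ~ (GKdim R I' < +oo)%E.
Proof.
move=> yz; set p := marr x i; set q := marr y _; set t := marr z _ => pq qt tp.
have [j [l [lD lq]]] : exists j l,
    path D q (marr y j :: l) /\ last q (marr y j :: l) = q.
  have sr0 : (0 < s * r)%N by rewrite muln_gt0 (leq_trans _ s4) // (leq_trans _ r4).
  have := last_line y (i + step x) (s * r); have := line_path y (i + step x) (s * r).
  rewrite mulrn_period addr0; case: (s * r)%N sr0 => // n _ pn ln.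
  by do 2 eexists; split; [exact: pn | exact: ln].
have c0 : cycle D (p :: [:: q; t]) by rewrite /= pq qt tp.
have c1 : cycle D (p :: q :: rcons (marr y j :: l) t).
  move: lD lq => /= /andP[qj lD] lq.
  by rewrite pq qj !rcons_path lD last_rcons lq qt tp.
apply: (rigid_cycles_GKdim I'D Dcomp (cycle_cat c0 c1) (cycle_cat c1 c0)).
  by rewrite !size_cat /= addnC !addSn !addnS.
by rewrite /= !eqseq_cons; apply/negP => /and3P[_ /eqP/marr_dir/esym/yz].
Qed.

End Growth.
End McKay.

(** * Squares and their relations *)

Section McKayDual.
Variables (R : realType) (k : fieldType) (s r : nat).
Local Notation Q := (mckay s r).
Local Notation kQ := (path_alg k Q).
Local Notation V := (mvertex s r).
Implicit Types (i j : V) (x y z : dir).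
Variable rho : set kQ.
Hypotheses (s4 : (4 <= s)%N) (r4 : (4 <= r)%N).
Hypothesis rho2 : rho `<=` path_deg 2.
Hypothesis trivI : trivial_stable_translation 2 (ideal_gen rho).
Local Notation I := (ideal_gen rho).
Local Notation Idual := (ideal_gen (quad_perp rho)).

Definition path2 x y i : kQ := parrow k (marr y (i + step s r x)) * parrow k (marr x i).

Lemma path2_from_to x y i :
  @from_to k Q i (i + step s r x + step s r y) (path2 x y i).
Proof.
have := @from_to_arrow2 k Q (marr x i) (marr y (i + step s r x)).
by rewrite !(target_marr, source_marr); apply.
Qed.

Lemma path2_same x i : ideal_set I (path2 x x i).
Proof.
apply: (relation_no_arrow rho2 trivI (mckay_out_arrow (r:=r))
  (mckay_no_short_cycle s4 r4)).
  by rewrite target_marr source_marr.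
move=> c; have [y [j ->]] := marrP c; rewrite !(source_marr, target_marr) => -> e.
apply: (@step2D_eq0 _ _ s4 r4 x y); apply: (@addrI _ i).
by rewrite addr0 !addrA.
Qed.

Lemma step_completes x y : x <> y ->
  exists2 z, y <> z & step s r x + step s r y + step s r z = 0.
Proof.
case: x; case: y => // _; 
  [exists DirC|exists DirB|exists DirC|exists DirA|exists DirB|exists DirA] => //;
  by rewrite !stepE !zvecD.
Qed.

(** A vanishing path of length 2 with arrows of different types is one side of
    a triangle all of whose two-step paths vanish, by rotation.  These, with
    the straight paths, make the triangle and the straight lines rigid in the
    dual. *)
Lemma path2_nonzero (I' : ideal k Q) x y i :
    ideal_set I' = ideal_set Idual -> (GKdim R I' < +oo)%E -> x <> y ->
  ~ ideal_set I (path2 x y i).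
Proof.
move=> eI gk xy Iqp; have [z yz xyz] := step_completes xy.
pose D (a b : arrow Q) :=
  (target a == source b) && `[< ideal_set I (parrow k b * parrow k a) >].
have Dline w j : D (marr w j) (marr w (j + step s r w)).
  by rewrite /D target_marr source_marr eqxx; apply/asboolP/path2_same.
have Dcomp a b : D a b -> target a = source b by case/andP => /eqP.
have I'D f : ideal_set I' f -> forall v u, sorted D u -> f v u = 0.
  rewrite eI => /(@ideal_gen_min _ _ _ (avoid_ideal k D)); apply => g gperp v u uD.
  have [[j [l [g2 _]]] _] := gperp.
  have [/(g2 v u)|] := boolP (g v u != 0); last by rewrite negbK => /eqP.
  case: u uD => [|a [|b []]] //= /andP[/andP[_ /asboolP ab] _] _.
  exact: (quad_perp_coef0 rho2 v gperp ab).
set p := marr x i; set q := marr y (i + step s r x).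
set t := marr z (i + step s r x + step s r y).
have pq : target p = source q by rewrite target_marr source_marr.
have qt : target q = source t by rewrite target_marr source_marr.
have tp : target t = source p.
  by rewrite target_marr source_marr -!addrA [X in i + X]addrA xyz addr0.
have rot := relation_rotate rho2 trivI (mckay_out_arrow (r:=r))
  (mckay_no_short_cycle s4 r4) (mckay_parallel s4 r4).
have Itq := rot p q t pq qt tp Iqp.
have Ipt := rot q t p qt tp pq Itq.
have DI a b : target a = source b -> ideal_set I (parrow k b * parrow k a) -> D a b.
  by move=> ab Iab; rewrite /D ab eqxx; apply/asboolP.
apply: (rigid_triangle_GKdim s4 r4 Dline I'D Dcomp yz _ _ _ gk).
- exact: DI pq Iqp.
- exact: DI qt Itq.
- exact: DI tp Ipt.
Qed.

(** The relation named after an arrow type involves the two other types; in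
    its term carrying the scalar, [first_dir] is traversed before
    [second_dir]. *)
Definition first_dir x := match x with DirA | DirB => DirC | DirC => DirA end.
Definition second_dir x := match x with DirA | DirC => DirB | DirB => DirA end.

Definition zrel x i (c : k) : kQ :=
  c *: path2 (first_dir x) (second_dir x) i + path2 (second_dir x) (first_dir x) i.

Lemma zrel_deg x i c : path_deg 2 (zrel x i c).
Proof. by apply: path_degD; [apply: path_degZ|]; apply: path_deg_arrow2. Qed.

Lemma zrel_from_to x i c :
  @from_to k Q i (i + step s r (first_dir x) + step s r (second_dir x)) (zrel x i c).
Proof.
apply: from_toD; first exact/from_toZ/path2_from_to.
by rewrite addrAC; apply: path2_from_to.
Qed.

Lemma first_second x : first_dir x <> second_dir x. Proof. by case: x. Qed.

Lemma distinct_dirs x y : x <> y -> exists z,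
  first_dir z = x /\ second_dir z = y \/ first_dir z = y /\ second_dir z = x.
Proof.
case: x; case: y => // _;
  [exists DirC|exists DirB|exists DirC|exists DirA|exists DirB|exists DirA]; by auto.
Qed.

Lemma rho_perpP (c : dir -> V -> k) f :
  rho_perp (c DirA) (c DirB) (c DirC) f <-> exists x i, f = zrel x i (- (c x i)^-1).
Proof.
split=> [[i [->|->|->]]|[x [i ->]]].
- by exists DirA, i.
- by exists DirB, i.
- by exists DirC, i.
by exists i; case: x; [apply: Or31|apply: Or32|apply: Or33].
Qed.

Lemma path2_neq x y i : x <> y ->
  [:: marr x i; marr y (i + step s r x)] != [:: marr y i; marr x (i + step s r y)].
Proof. by move=> xy; apply/eqP => -[/marr_dir]. Qed.

Hypothesis nonzero : forall x y i, x <> y -> ~ ideal_set I (path2 x y i).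

Lemma square_ratio x y i : x <> y ->
  exists2 c : k, c != 0 & ideal_set I (path2 y x i - c *: path2 x y i).
Proof.
move=> xy.
have ft' := path2_from_to y x i; rewrite addrAC in ft'.
have [c hc] := deg2_le1 rho2 trivI (mckay_out_arrow (r:=r))
  (mckay_no_short_cycle s4 r4) (mckay_parallel s4 r4) (path2_from_to x y i)
  (@path_deg_arrow2 k Q _ _) ft' (@path_deg_arrow2 k Q _ _) (@nonzero _ _ i xy).
exists c => //; apply: contra_notN (@nonzero _ _ i (nesym xy)) => /eqP c0.
by move: hc; rewrite c0 scale0r subr0.
Qed.

Lemma quad_perp_zrel x i (c : k) f : c != 0 ->
    ideal_set I (path2 (second_dir x) (first_dir x) i -
      c *: path2 (first_dir x) (second_dir x) i) ->
    path_deg 2 f ->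
    @from_to k Q i (i + step s r (first_dir x) + step s r (second_dir x)) f ->
  (quad_perp rho f <-> exists t : k, f = t *: zrel x i c^-1).
Proof.
move=> c0 Ic f2 ff; set u := first_dir x; set v := second_dir x.
have uv : u <> v by apply: first_second.
have H := @quad_perp_square k Q rho rho2 i (i + step s r u + step s r v)
  (marr u i) (marr v (i + step s r u)) (marr v i) (marr u (i + step s r v)) c.
have {H} := H (source_marr _ _) _ (target_marr _ _) (source_marr _ _) _ _
  (path2_neq i uv) _ (@nonzero _ _ i uv) Ic f f2 ff.
rewrite !(target_marr, source_marr) addrAC => H.
have -> : quad_perp rho f <->
    exists t : k, f = t *: (path2 u v i + c *: path2 v u i).
  apply: H => // a b; have [a' [j ->]] := marrP a; have [b' [l ->]] := marrP b.
  rewrite !(target_marr, source_marr) => -> <- /eqP.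
  rewrite -!addrA (inj_eq (addrI i)) => /eqP/(step2_inj s4 r4 uv).
  by case=> -[-> ->]; [left|right].
have e : path2 u v i + c *: path2 v u i = c *: zrel x i c^-1.
  by rewrite /zrel scalerDr scalerA divff // scale1r.
split=> -[t ->]; first by exists (t * c); rewrite e scalerA.
by exists (t / c); rewrite e scalerA divfK.
Qed.

End McKayDual.

Theorem proposition5p4 (R : realType) (k : fieldType) (s r : nat)
    (I' : ideal k (mckay s r)) (rho : set (path_alg k (mckay s r))) :
  (4 <= s)%N -> (4 <= r)%N ->
  rho `<=` path_deg 2 ->
  trivial_stable_translation 2 (ideal_gen rho) ->
  ideal_set I' = ideal_set (ideal_gen (quad_perp rho)) ->
  koszul I' ->
  AS_regular 3 I' ->
  (GKdim R I' < +oo)%E ->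
  exists a b c : mvertex s r -> k,
    (forall i, [/\ a i != 0, b i != 0 & c i != 0]) /\
    ideal_set I' = ideal_set (ideal_gen (rho_perp a b c)).
Proof.
move=> s4 r4 rho2 trivI eI _ _ gk.
have nonzero x y i : x <> y -> ~ ideal_set (ideal_gen rho) (path2 k x y i).
  exact: (path2_nonzero s4 r4 rho2 trivI eI gk).
have ratio x i : exists c : k, c != 0 /\ ideal_set (ideal_gen rho)
    (path2 k (second_dir x) (first_dir x) i -
     c *: path2 k (first_dir x) (second_dir x) i).
  have [c c0 hc] := square_ratio s4 r4 rho2 trivI nonzero i (@first_second x).
  by exists c.
have /choice[c hc] : forall xi : dir * mvertex s r, exists c : k, c != 0 /\
    ideal_set (ideal_gen rho) (path2 k (second_dir xi.1) (first_dir xi.1) xi.2 -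
      c *: path2 k (first_dir xi.1) (second_dir xi.1) xi.2).
  by move=> xi; apply: ratio.
(* If u and u' are the two paths around a square and u' = c u in L, the dual
   relation u + c u' spans the same line as c^-1 u + u', whose scalar c^-1 has
   to be written as - (d x i)^-1. *)
pose d x i := - c (x, i).
exists (d DirA), (d DirB), (d DirC); split.
  have d0 x i : d x i != 0 by rewrite oppr_eq0; case: (hc (x, i)).
  by move=> i; split; apply: d0.
have dE x i : - (d x i)^-1 = (c (x, i))^-1 by rewrite /d invrN opprK.
have perpE x i f := quad_perp_zrel s4 r4 rho2 nonzero (f := f) (hc (x, i)).1 (hc (x, i)).2.
rewrite eI; apply/seteqP; split; apply: ideal_gen_min => f.
  move=> fperp; have [[i [j [f2 fij]]] _] := fperp.
  have [[x jE]|nosq] := pselect (exists x,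
      j = i + step s r (first_dir x) + step s r (second_dir x)).
    subst j; have [t ->] := (perpE x i f f2 fij).1 fperp.
    apply/ideal_scale/sub_ideal_gen/rho_perpP.
    by exists x, i; rewrite dE.
  (* The only paths of length 2 between vertices that are not opposite corners
     of a square are straight, and f has coefficient zero at those. *)
  rewrite (_ : f = 0); first exact: ideal0.
  apply: path_algP => v u; apply/eqP; apply: contra_notT nosq => fv.
  have [vi we cu] := from_to_support fij fv; subst v.
  move: (f2 _ _ fv) => u2; move: u2 we fv cu; case: u => [|a [|b []]] // _.
  cbn [walk_end composable].
  have [x [i' ->]] := marrP a; have [y [i'' ->]] := marrP b.
  rewrite !(source_marr, target_marr) => bj fv /and3P[/eqP ii' /eqP ii'' _].
  subst i' i''.
  have [xy|xy] := pselect (x = y).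
    subst y; case/eqP: fv; apply: (quad_perp_coef0 rho2 i fperp).
    exact: path2_same.
  have [z [[zx zy]|[zy zx]]] := distinct_dirs xy; exists z; rewrite zx zy //.
  by rewrite addrAC.
move=> /rho_perpP[x [i ->]]; apply: sub_ideal_gen; rewrite dE.
apply/(perpE x i); [exact: zrel_deg | exact: zrel_from_to |].
by exists 1; rewrite scale1r.
Qed.
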